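(* If $\rho\subseteq\mathbb N$ is a recursive (decidable) set of integers and $P$ is a recursive (decidable) property of graphs, then the parameterized problem $(P,\rho)$-\textsc{Dominating Set of Size at Most} $k$ belongs to $\mathrm{W}[2]$.
   Context: Graphs are finite, simple and undirected; $N(v)$ denotes the open neighbourhood of $v$. $(P,\rho)$-\textsc{Dominating Set of Size at Most} $k$ (for fixed $P,\rho$): Input: a graph $G=(V,E)$ and an integer $k$. Parameter: $k$. Question: is there a subset $D\subseteq V$ with $|D|\le k$ such that the subgraph of $G$ induced by $D$ satisfies $P$, and every $v\in V\setminus D$ satisfies $|N(v)\cap D|\in\rho$? *)

(* Defs.v *)
From mathcomp Require Import all_boot.

Set Implicit Arguments.
Unset Strict Implicit.
Unset Printing Implicit Defensive.

(* Model of computation: the WHILE language over binary trees (N. D. Jones,  *)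
(* "Computability and Complexity from a Programming Perspective"), in which  *)
(* trees play the role of strings over a finite alphabet.                    *)

Inductive tree : Type := Leaf | Node of tree & tree.

Fixpoint tsize (x : tree) : nat :=
  if x is Node a b then (tsize a + tsize b).+1 else 1.

Definition is_node (x : tree) : bool := if x is Node _ _ then true else false.
Definition thead (x : tree) : tree := if x is Node a _ then a else Leaf.
Definition ttail (x : tree) : tree := if x is Node _ b then b else Leaf.

Inductive expr : Type :=
| EVar of nat
| ELeaf
| ENode of expr & expr
| EHead of expr
| ETail of expr.

Inductive prog : Type :=
| Assign of nat & expr
| Seq of prog & prog
| If of expr & prog & prog
| While of expr & prog.

Definition store := nat -> tree.

Definition upd (s : store) (i : nat) (v : tree) : store :=
  fun j => if j == i then v else s j.

Fixpoint eval (s : store) (e : expr) : tree :=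
  match e with
  | EVar i => s i
  | ELeaf => Leaf
  | ENode e1 e2 => Node (eval s e1) (eval s e2)
  | EHead e1 => thead (eval s e1)
  | ETail e1 => ttail (eval s e1)
  end.

(* [exec p s t s']: started in store s, the program p halts in store s' after *)
(* time t.  An assignment is charged the full size of the tree it stores (no  *)
(* sharing of subtrees is assumed), so that every tree in the store has size  *)
(* at most the input size plus the elapsed time, and time is polynomially     *)
(* related to the number of steps of a Turing machine.                        *)
Inductive exec : prog -> store -> nat -> store -> Prop :=
| exec_assign i e s :
    exec (Assign i e) s (tsize (eval s e)) (upd s i (eval s e))
| exec_seq p q s s' s'' t u :
    exec p s t s' -> exec q s' u s'' -> exec (Seq p q) s (t + u) s''
| exec_if_true e p q s s' t :
    is_node (eval s e) -> exec p s t s' -> exec (If e p q) s t.+1 s'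
| exec_if_false e p q s s' t :
    ~~ is_node (eval s e) -> exec q s t s' -> exec (If e p q) s t.+1 s'
| exec_while_true e p s s' s'' t u :
    is_node (eval s e) -> exec p s t s' -> exec (While e p) s' u s'' ->
    exec (While e p) s (t + u).+1 s''
| exec_while_false e p s :
    ~~ is_node (eval s e) -> exec (While e p) s 1 s.

(* Variable 0 carries both the input and the output. *)
Definition computes_in (p : prog) (x : tree) (t : nat) (y : tree) : Prop :=
  exists2 s', exec p (upd (fun=> Leaf) 0 x) t s' & s' 0 = y.

Definition computes (p : prog) (x y : tree) : Prop :=
  exists t, computes_in p x t y.

Definition code_bool (b : bool) : tree := if b then Node Leaf Leaf else Leaf.

Definition code_seq (T : Type) (code : T -> tree) (l : seq T) : tree :=
  foldr (fun a x => Node (code a) x) Leaf l.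

(* Unary. *)
Definition code_nat (n : nat) : tree := iter n (Node Leaf) Leaf.

Definition computable (f : nat -> nat) : Prop :=
  exists p, forall n, computes p (code_nat n) (code_nat (f n)).

Definition recursive (T : Type) (code : T -> tree) (A : T -> Prop) : Prop :=
  exists p, forall a,
    exists2 b : bool, computes p (code a) (code_bool b) & (A a <-> b).

(* A parameterized problem is a set of pairs (encoded input, parameter);      *)
(* trees that encode no input are no-instances.                               *)
Definition pproblem := tree -> nat -> Prop.

Definition fpt_reducible (L L' : pproblem) : Prop :=
  exists (p : prog) (f g : nat -> nat) (c : nat),
    [/\ computable f, computable g &
      forall x k, exists x' k' t,
        [/\ computes_in p (Node x (code_nat k)) t (Node x' (code_nat k')),
            t <= f k * tsize x ^ c,
            k' <= g k &
            (L x k <-> L' x' k')]].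

(* Boolean decision circuits.  The nodes of a circuit with n inputs are       *)
(* numbered: 0, ..., n - 1 are the inputs and n + i is the i-th gate, whose   *)
(* arguments are nodes with smaller numbers.                                  *)
Inductive gate : Type :=
| Not of nat
| And of seq nat
| Or of seq nat.

Definition gate_args (g : gate) : seq nat :=
  match g with Not a => [:: a] | And l => l | Or l => l end.

Record circuit : Type := Circuit {
  inputs : nat;
  gates : seq gate;
  output : nat }.

Definition wf_circuit (C : circuit) : Prop :=
  output C < inputs C + size (gates C) /\
  forall i, i < size (gates C) ->
    all (fun a => a < inputs C + i) (gate_args (nth (And [::]) (gates C) i)).

(* The values at all the nodes, given those at the inputs and the rule that   *)
(* yields the value at a gate from the values at the preceding nodes.         *)
Definition node_values (A : Type) (rule : seq A -> gate -> A)
    (init : seq A) (gs : seq gate) : seq A :=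
  foldl (fun vs g => rcons vs (rule vs g)) init gs.

Definition gate_value (vs : seq bool) (g : gate) : bool :=
  match g with
  | Not a => ~~ nth false vs a
  | And l => all (nth false vs) l
  | Or l => has (nth false vs) l
  end.

Definition circuit_value (C : circuit) (x : (inputs C).-tuple bool) : bool :=
  nth false (node_values gate_value x (gates C)) (output C).

(* The maximum, over the paths that end at the output, of the number of gates *)
(* satisfying a on the path.                                                  *)
Definition path_max (a : pred gate) (C : circuit) : nat :=
  nth 0 (node_values
           (fun vs g => a g + \max_(j <- gate_args g) nth 0 vs j)
           (nseq (inputs C) 0) (gates C)) (output C).

Definition large (g : gate) : bool := 2 < size (gate_args g).

Definition depth : circuit -> nat := path_max predT.
Definition weft : circuit -> nat := path_max large.

Definition code_gate (g : gate) : tree :=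
  match g with
  | Not a => Node (code_nat 0) (code_nat a)
  | And l => Node (code_nat 1) (code_seq code_nat l)
  | Or l => Node (code_nat 2) (code_seq code_nat l)
  end.

Definition code_circuit (C : circuit) : tree :=
  Node (code_nat (inputs C))
       (Node (code_seq code_gate (gates C)) (code_nat (output C))).

Definition weighted_circuit_sat (t h : nat) : pproblem := fun x k =>
  exists C : circuit,
    [/\ x = code_circuit C, wf_circuit C, weft C <= t, depth C <= h &
      exists2 y : (inputs C).-tuple bool, count id y = k & circuit_value y].

Definition W (t : nat) (L : pproblem) : Prop :=
  exists h, fpt_reducible L (weighted_circuit_sat t h).

Record sgraph : Type := SGraph {
  vertex :> finType;
  adj : rel vertex;
  adj_sym : symmetric adj;
  adj_irrefl : irreflexive adj }.

Definition nbh (G : sgraph) (v : G) : {set G} := [set u | adj v u].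

Section Induced.
Variables (G : sgraph) (D : {set G}).

Definition induced_adj : rel {x : G | x \in D} :=
  fun u v => adj (val u) (val v).

Lemma induced_adj_sym : symmetric induced_adj.
Proof. by move=> u v; apply: adj_sym. Qed.

Lemma induced_adj_irrefl : irreflexive induced_adj.
Proof. by move=> u; apply: adj_irrefl. Qed.

Definition induced : sgraph := SGraph induced_adj_sym induced_adj_irrefl.

End Induced.

Definition isomorphic (G H : sgraph) : Prop :=
  exists2 f : G -> H, bijective f & forall u v, adj (f u) (f v) = adj u v.

Definition graph_property (P : sgraph -> Prop) : Prop :=
  forall G H, isomorphic G H -> P G -> P H.

(* Adjacency matrix, with the vertices in the order of [enum G]. *)
Definition code_graph (G : sgraph) : tree :=
  code_seq (code_seq code_bool) [seq [seq adj u v | v <- enum G] | u <- enum G].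

Definition dominating_set_of_size_at_most
    (P : sgraph -> Prop) (rho : nat -> Prop) : pproblem := fun x k =>
  exists2 G : sgraph, x = code_graph G &
    exists D : {set G},
      [/\ #|D| <= k, P (induced D) &
          forall v, v \notin D -> rho #|nbh v :&: D|].

(* Main.v *)
Require Import Defs.
From mathcomp Require Import all_boot.
From HB Require Import structures.
From mathcomp Require Import zify.
From Stdlib Require Import IndefiniteDescription.

(* Input slots are pairs (i, u) with i < k and u <= n: block i chooses the i-th
   vertex of D, the slot u = n meaning that it chooses none.  A monotone circuit
   (a conjunction of clauses, each a disjunction of conjunctions of two slots)
   is enough: with k disjoint blocks, an assignment of weight k that meets every
   block chooses exactly one slot in each, so "the chosen vertices do not realise
   the bad pattern M" is the disjunction over i, j of the pairs of slots of the
   blocks i and j whose link (non-adjacent, adjacent or equal) is not M i j.  The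
   bad k x k patterns are those with a repeated vertex or violating P; a vertex v
   excludes the words of length k, describing the links from v to the chosen
   vertices, in which v is not chosen and the number of adjacencies is not in rho.
   These finitely many patterns depend on k alone, and are tabulated by a program
   with no time bound; the rest is polynomial in the input and the table.  The
   running time of the tabulation is bounded by a computable function, obtained
   by making the program record its own execution. *)

(** A circuit of bounded depth cannot evaluate an arbitrary recursive [P] or [rho]. But [P] only
    sees the links among at most k chosen vertices, and [rho] only counts up to k, so for each k
    both become finite tables, and the circuit merely excludes bad rows. Excluding one row is one
    disjunction, and all rows together are one conjunction. The conjunctions of two slots have two
    arguments and are not large, so the weft is 2 and the depth 3 however long the table is. The
    slot that chooses no vertex reconciles a set of size at most k with an assignment of weight
    exactly k. The obstacle is the time bound: f must be computable, while the decision programs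
    come with no bound at all, and a time function obtained by choice alone need not be computable.
    Moreover these programs may diverge on trees that are not codes, so running times are stated
    relative to a domain, and [P] is only consulted behind a test for being the code of a graph. *)

Set Implicit Arguments.
Unset Strict Implicit.
Unset Printing Implicit Defensive.

(** * Programs *)

(* [tsize] and [thead] also name functions of tuple.v. *)
Notation tsize := Defs.tsize.
Notation thead := Defs.thead.

Lemma tsize_gt0 x : 0 < tsize x. Proof. by case: x. Qed.

Notation start x := (upd (fun=> Leaf) 0 x).

(** Makes the answer of a decision program depend on the code alone: distinct graphs with the same
    code get the same verdict. *)
Lemma exec_det p s t s1 : exec p s t s1 -> forall u s2, exec p s u s2 -> s1 = s2.
Proof.
elim=> {p s t s1}
  [i e s|p q s s' s'' t u _ IHp _ IHq|e p q s s' t He _ IH|e p q s s' t He _ IH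
  |e p s s' s'' t u He _ IHp _ IHw|e p s He] v s2 H; inversion H; subst => //;
  repeat match goal with
  | H1 : is_true (is_node ?x), H2 : is_true (~~ is_node ?x) |- _ =>
      by rewrite H1 in H2
  | IH : forall u s2, exec ?p ?s u s2 -> _ = s2, H : exec ?p ?s _ _ |- _ =>
      rewrite -?(IH _ _ H) in H *; move: (IH _ _ H) => ?; clear IH; subst
  end => //.
Qed.

Lemma exec_size p s t s' : exec p s t s' ->
  forall B, (forall i, tsize (s i) <= B) -> forall i, tsize (s' i) <= B + t.
Proof.
elim=> {p s t s'}
  [i e s|p q s s' s'' t u _ IHp _ IHq|e p q s s' t _ _ IH|e p q s s' t _ _ IH
  |e p s s' s'' t u _ _ IHp _ IHw|e p s _] B HB j.
- rewrite /upd; case: eqP => _; first exact: leq_addl.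
  exact: leq_trans (HB j) (leq_addr _ _).
- by rewrite addnA; apply: IHq; apply: IHp.
- by rewrite addnS leqW // IH.
- by rewrite addnS leqW // IH.
- by rewrite addnS leqW // addnA; apply: IHw; apply: IHp.
- exact: leq_trans (HB j) (leq_addr _ _).
Qed.

Lemma computes_in_size p x t y : computes_in p x t y -> tsize y <= tsize x + t.
Proof.
case=> s' H <-; apply: (exec_size H) => i; rewrite /upd.
by case: eqP => // _; apply: tsize_gt0.
Qed.

Fixpoint ebound (e : expr) : nat :=
  match e with
  | EVar i => i.+1
  | ELeaf => 0
  | ENode e1 e2 => maxn (ebound e1) (ebound e2)
  | EHead e1 => ebound e1
  | ETail e1 => ebound e1
  end.

Fixpoint pbound (p : prog) : nat :=
  match p with
  | Assign i e => maxn i.+1 (ebound e)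
  | Seq p q => maxn (pbound p) (pbound q)
  | If e p q => maxn (ebound e) (maxn (pbound p) (pbound q))
  | While e p => maxn (ebound e) (pbound p)
  end.

Fixpoint eshift (m : nat) (e : expr) : expr :=
  match e with
  | EVar i => EVar (m + i)
  | ELeaf => ELeaf
  | ENode e1 e2 => ENode (eshift m e1) (eshift m e2)
  | EHead e1 => EHead (eshift m e1)
  | ETail e1 => ETail (eshift m e1)
  end.

Fixpoint pshift (m : nat) (p : prog) : prog :=
  match p with
  | Assign i e => Assign (m + i) (eshift m e)
  | Seq p q => Seq (pshift m p) (pshift m q)
  | If e p q => If (eshift m e) (pshift m p) (pshift m q)
  | While e p => While (eshift m e) (pshift m p)
  end.

Lemma eval_shift m N e (s S : store) : ebound e <= N ->
  (forall i, i < N -> S (m + i) = s i) -> eval S (eshift m e) = eval s e.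
Proof.
move=> He HS; elim: e He => //=.
- by move=> e1 IH1 e2 IH2; rewrite geq_max => /andP[/IH1-> /IH2->].
- by move=> e1 IH /IH->.
- by move=> e1 IH /IH->.
Qed.

(** Stack discipline: the cells below [m] are the caller's frame and survive. Agreement is required
    only on the finitely many cells that [p] can mention, since a running program can clear only
    finitely many. *)
Lemma exec_shift m N p s t s' : exec p s t s' -> pbound p <= N ->
  forall S : store, (forall i, i < N -> S (m + i) = s i) ->
  exists S', [/\ exec (pshift m p) S t S', forall i, i < N -> S' (m + i) = s' i
               & forall j, j < m -> S' j = S j].
Proof.
elim=> {p s t s'}
  [i e s|p q s s' s'' t u _ IHp _ IHq|e p q s s' t He _ IH|e p q s s' t He _ IH
  |e p s s' s'' t u He _ IHp _ IHw|e p s He] /=; rewrite ?geq_max.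
- case/andP=> ltiN leN S HS; exists (upd S (m + i) (eval s e)); split.
  + by rewrite -(eval_shift leN HS); apply: exec_assign.
  + by move=> j ltjN; rewrite /upd eqn_add2l HS.
  + by move=> j ltjm; rewrite /upd; case: eqP => // def_j; lia.
- case/andP=> /IHp{}IHp /IHq{}IHq S /IHp[S1 [H1 E1 F1]].
  case: (IHq _ E1) => S2 [H2 E2 F2]; exists S2; split=> //.
    exact: exec_seq H1 H2.
  by move=> j ltjm; rewrite F2 // F1.
- case/and3P=> leN /IH{}IH _ S HS; have [S1 [H1 E1 F1]] := IH _ HS.
  exists S1; split=> //; apply: exec_if_true => //.
  by rewrite (eval_shift leN HS).
- case/and3P=> leN _ /IH{}IH S HS; have [S1 [H1 E1 F1]] := IH _ HS.
  exists S1; split=> //; apply: exec_if_false => //.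
  by rewrite (eval_shift leN HS).
- case/andP=> leN lepN S HS; have [S1 [H1 E1 F1]] := IHp lepN _ HS.
  have [|S2 [H2 E2 F2]] := IHw _ _ E1; first by rewrite /= geq_max leN.
  exists S2; split=> //.
    by apply: exec_while_true H1 H2; rewrite (eval_shift leN HS).
  by move=> j ltjm; rewrite F2 // F1.
- case/andP=> leN _ S HS; exists S; split=> //.
  by apply: exec_while_false; rewrite (eval_shift leN HS).
Qed.

Lemma exec_seqs p q s s' s'' t u v : exec p s t s' -> exec q s' u s'' ->
  v = t + u -> exec (Seq p q) s v s''.
Proof. by move=> Hp Hq ->; apply: exec_seq Hp Hq. Qed.

Lemma exec_assign_to i e s y : eval s e = y -> exec (Assign i e) s (tsize y) (upd s i y).
Proof. by move=> <-; apply: exec_assign. Qed.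

Fixpoint clear (m n : nat) : prog :=
  if n is n'.+1 then Seq (clear m n') (Assign (m + n).+1 ELeaf)
  else Assign m.+1 ELeaf.

Lemma exec_clear m n (s : store) :
  exists s', [/\ exec (clear m n) s n.+1 s',
    forall i, 0 < i <= n.+1 -> s' (m + i) = Leaf & forall j, j <= m -> s' j = s j].
Proof.
elim: n => [|n [s' [H E F]]] /=.
  exists (upd s m.+1 Leaf); split; first exact: (exec_assign _ ELeaf).
    by move=> i Hi; (have ->: i = 1 by lia); rewrite addn1 /upd eqxx.
  by move=> j lejm; rewrite /upd; case: eqP => // ?; lia.
exists (upd s' (m + n.+1).+1 Leaf); split.
- by apply: (exec_seqs H (exec_assign _ ELeaf _)); rewrite addn1.
- by move=> i Hi; rewrite /upd; case: eqP => // ?; apply: E; lia.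
- by move=> j lejm; rewrite /upd; case: eqP => [?|_]; [lia|apply: F].
Qed.

(* The cells after [m] are cleared so that [p] sees a fresh store. *)
Definition call (m : nat) (p : prog) : prog :=
  Seq (clear m (pbound p)) (pshift m p).

(** The overhead of a call is the number of cleared cells, a constant of [p]; it becomes the
    constant [K] of the combinators below. *)
Lemma exec_call m p x t y (s : store) : computes_in p x t y -> s m = x ->
  exists s', [/\ exec (call m p) s ((pbound p).+1 + t) s', s' m = y
               & forall j, j < m -> s' j = s j].
Proof.
case=> s1 Hp <- Hm; have [s2 [H2 E2 F2]] := exec_clear m (pbound p) s.
have [|s3 [H3 E3 F3]] := exec_shift Hp (leqnSn (pbound p)) (S := s2) (m := m).
  case=> [|i]; first by rewrite addn0 F2.
  by move=> lti; rewrite E2 //=; apply: ltnW.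
exists s3; split; first exact: exec_seq H2 H3.
  by have := E3 0 isT; rewrite addn0.
by move=> j ltjm; rewrite F3 // F2 // ltnW.
Qed.

(** The domain [D] accommodates programs whose halting or running time is only known on codes, such
    as the decision program for [P]. *)
Definition runs (D : tree -> Prop) (f : tree -> tree) (T : tree -> nat) :=
  exists p, forall x, D x -> exists2 t, computes_in p x t (f x) & t <= T x.

Lemma runs_size D f T x : runs D f T -> D x -> tsize (f x) <= tsize x + T x.
Proof.
case=> p Hp /Hp[t /computes_in_size Hf leT].
by rewrite (leq_trans Hf) // leq_add2l.
Qed.

Lemma runs_expr e : runs xpredT (fun x => eval (start x) e)
                                (fun x => tsize (eval (start x) e)).
Proof.
exists (Assign 0 e) => x _; exists (tsize (eval (start x) e)) => //.
by exists (upd (start x) 0 (eval (start x) e)) => //; apply: exec_assign.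
Qed.

Lemma runs_comp D D' f g Tf Tg : (forall x, D x -> D' (g x)) ->
  runs D' f Tf -> runs D g Tg ->
  exists K, runs D (fun x => f (g x)) (fun x => Tg x + (K + Tf (g x))).
Proof.
move=> DD' [pf Hf] [pg Hg]; exists (pbound pf).+1, (Seq pg (call 0 pf)) => x Dx.
have [tg [s1 H1 E1] le1] := Hg x Dx; have [tf Hc le2] := Hf _ (DD' x Dx).
have [s2 [H2 E2 _]] := exec_call Hc E1.
exists (tg + ((pbound pf).+1 + tf)); last by rewrite leq_add // leq_add2l.
by exists s2 => //; apply: exec_seq H1 H2.
Qed.

Lemma runs_pair D f g Tf Tg : runs D f Tf -> runs D g Tg ->
  exists K, runs D (fun x => Node (f x) (g x))
    (fun x => K + tsize x * 4 + Tf x * 2 + Tg x * 2).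
Proof.
move=> [pf Hf] [pg Hg]; exists ((pbound pf).+1 + (pbound pg).+1 + 1).
exists (Seq (Assign 1 (EVar 0)) (Seq (call 1 pf) (Seq (Assign 2 (EVar 0))
         (Seq (call 2 pg) (Assign 0 (ENode (EVar 1) (EVar 2))))))) => x Dx.
have [tf Hcf lef] := Hf x Dx; have [tg Hcg leg] := Hg x Dx.
have H0 := @exec_assign_to 1 (EVar 0) (start x) x erefl.
have [s1 [H1 E1 F1]] := exec_call Hcf (erefl : upd (start x) 1 x 1 = x).
have s1_0 : s1 0 = x by rewrite F1.
have H2 := @exec_assign_to 2 (EVar 0) s1 x s1_0.
have [s2 [H3 E3 F3]] := exec_call Hcg (erefl : upd s1 2 x 2 = x).
have s2_1 : s2 1 = f x by rewrite F3.
have H4 := @exec_assign_to 0 (ENode (EVar 1) (EVar 2)) s2 (Node (f x) (g x)).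
rewrite /= s2_1 E3 in H4; move/(_ erefl) in H4.
eexists.
  by eexists; first exact: exec_seq H0 (exec_seq H1 (exec_seq H2 (exec_seq H3 H4))).
(* The input is copied twice, and each component of the final pair has size at most the input size
   plus its own time: hence the factors 4 and 2. *)
have := computes_in_size Hcf; have := computes_in_size Hcg => /= *; lia.
Qed.

(** Each branch has to halt only where it is taken, so a test can protect a partial program. *)
Lemma runs_if D b f g Tb Tf Tg : runs D (fun x => code_bool (b x)) Tb ->
  runs (fun x => D x /\ b x) f Tf -> runs (fun x => D x /\ ~~ b x) g Tg ->
  exists K, runs D (fun x => if b x then f x else g x)
    (fun x => K + tsize x + Tb x + (if b x then Tf x else Tg x)).
Proof.
move=> [pb Hb] [pf Hf] [pg Hg].
exists ((pbound pb).+1 + (pbound pf).+1 + (pbound pg).+1 + 1).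
exists (Seq (Assign 1 (EVar 0)) (Seq (call 1 pb)
         (If (EVar 1) (call 0 pf) (call 0 pg)))) => x Dx.
have [tb Hcb leb] := Hb x Dx.
have H0 := @exec_assign_to 1 (EVar 0) (start x) x erefl.
have [s1 [H1 E1 F1]] := exec_call Hcb (erefl : upd (start x) 1 x 1 = x).
have s1_0 : s1 0 = x by rewrite F1.
have [bx|nbx] := boolP (b x).
  have [tf Hcf lef] := Hf x (conj Dx bx).
  have [s2 [H2 E2 F2]] := exec_call Hcf s1_0.
  eexists; first eexists; first apply: exec_seq H0 (exec_seq H1 _).
  - by apply: exec_if_true H2; rewrite /= E1 bx.
  - by [].
  - lia.
have [tg Hcg leg] := Hg x (conj Dx nbx).
have [s2 [H2 E2 F2]] := exec_call Hcg s1_0.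
eexists; first eexists; first apply: exec_seq H0 (exec_seq H1 _).
- by apply: exec_if_false H2; rewrite /= E1 (negPf nbx).
- by [].
- lia.
Qed.

(** * Loops over lists *)

Fixpoint elems (x : tree) : seq tree := if x is Node a y then a :: elems y else [::].

(** Every tree is the list of trees hanging off its right spine, so a loop may run over any tree
    without a check of its form. *)
Lemma code_elems x : code_seq id (elems x) = x.
Proof. by elim: x => //= a _ y ->. Qed.

Lemma elems_code T (c : T -> tree) l : elems (code_seq c l) = map c l.
Proof. by elim: l => //= a l ->. Qed.

Lemma tsize_elems x : tsize x = (\sum_(a <- elems x) (tsize a).+1).+1.
Proof. by elim: x => [|a _ y IH]; rewrite ?big_nil //= big_cons IH addSn addnS. Qed.

Section Fold.
Variables (p : prog) (S : tree -> tree).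

Notation step x := (fun acc a => S (Node x (Node a acc))).

(* [M] bounds the accumulators and the running times of the steps. *)
Fixpoint fold_ok (x : tree) (M : nat) (acc : tree) (l : seq tree) : Prop :=
  tsize acc <= M /\
  if l is a :: l' then
    (exists2 t, computes_in p (Node x (Node a acc)) t (step x acc a) & t <= M) /\
    fold_ok x M (step x acc a) l'
  else True.

(** Cell 1 holds the environment, 2 the accumulator, 3 the remaining list; the frame of the called
    step starts at cell 4. *)
Definition fold_loop : prog :=
  While (EVar 3) (Seq (Assign 4 (ENode (EVar 1) (ENode (EHead (EVar 3)) (EVar 2))))
    (Seq (call 4 p) (Seq (Assign 2 (EVar 4)) (Assign 3 (ETail (EVar 3)))))).

(** Per iteration, the three [M] pay for the accumulator, the step and its result, and the two [B]
    for the current element and the remaining list. *)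
Lemma exec_fold_loop x M l : forall (s : store) B,
  s 1 = x -> s 3 = l -> fold_ok x M (s 2) (elems l) -> tsize l <= B ->
  exists t s', [/\ exec fold_loop s t s', s' 2 = foldl (step x) (s 2) (elems l)
    & t <= size (elems l) * (pbound p + tsize x + B.*2 + M * 3 + 5) + 1].
Proof.
elim: l => [|a _ l IH] s B Ex El /= [leM ok] leB.
  by exists 1, s; split=> //; apply: exec_while_false; rewrite /= El.
case: ok => [[t Hc let_]] ok.
have H0 := @exec_assign_to 4 (ENode (EVar 1) (ENode (EHead (EVar 3)) (EVar 2)))
  s (Node x (Node a (s 2))).
rewrite /= Ex El in H0; move/(_ erefl) in H0.
have [s1 [H1 E1 F1]] :=
  exec_call (m := 4) (s := upd s 4 (Node x (Node a (s 2)))) Hc erefl.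
have H2 := @exec_assign_to 2 (EVar 4) s1 _ E1.
set s2 := upd s1 _ _ in H2.
have s2_3 : s2 3 = Node a l by rewrite /s2 /upd /= F1.
have H3 := @exec_assign_to 3 (ETail (EVar 3)) s2 l.
rewrite /= s2_3 in H3; move/(_ erefl) in H3; set s3 := upd s2 _ _ in H3.
have s3_1 : s3 1 = x by rewrite /s3 /s2 /upd /= F1.
have [|t' [s' [H4 E4 le4]]] := IH s3 B s3_1 erefl ok; first lia.
have leM' : tsize (S (Node x (Node a (s 2)))) <= M.
  by case: (elems l) ok => [|? ?] [].
eexists; exists s'; split.
- apply: exec_while_true H4; first by rewrite /= El.
  exact: exec_seq H0 (exec_seq H1 (exec_seq H2 H3)).
- exact: E4.
- by rewrite mulSn; lia.
Qed.

Definition fold_prog : prog :=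
  Seq (Assign 1 (EHead (EVar 0))) (Seq (Assign 2 (EHead (ETail (EVar 0))))
    (Seq (Assign 3 (ETail (ETail (EVar 0)))) (Seq fold_loop (Assign 0 (EVar 2))))).

Lemma fold_ok_last x M acc l : fold_ok x M acc l -> tsize (foldl (step x) acc l) <= M.
Proof. by elim: l acc => [|a l IH] acc /= [? //] [_ /IH]. Qed.

Lemma computes_fold x M acc l : fold_ok x M acc (elems l) ->
  exists2 t, computes_in fold_prog (Node x (Node acc l)) t (foldl (step x) acc (elems l))
    & t <= tsize l * (pbound p + tsize x + tsize l * 2 + M * 3 + 5) + 1
           + tsize x + tsize l + M * 2.
Proof.
move=> ok; set z := Node x _; set s0 := start z.
have H1 := @exec_assign_to 1 (EHead (EVar 0)) s0 x erefl.
set s1 := upd s0 _ _ in H1.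
have H2 := @exec_assign_to 2 (EHead (ETail (EVar 0))) s1 acc erefl.
set s2 := upd s1 _ _ in H2.
have H3 := @exec_assign_to 3 (ETail (ETail (EVar 0))) s2 l erefl.
set s3 := upd s2 _ _ in H3.
have [||t [s4 [H4 E4 le4]]] := @exec_fold_loop x M l s3 (tsize l) erefl erefl.
- exact: ok.
- exact: leqnn.
have H5 := @exec_assign_to 0 (EVar 2) s4 _ E4.
eexists.
  eexists; first exact: exec_seq H1 (exec_seq H2 (exec_seq H3 (exec_seq H4 H5))).
  by [].
have leM : tsize acc <= M by case: (elems l) ok => [|? ?] [].
have leF := fold_ok_last ok.
have le_l : size (elems l) <= tsize l.
  by rewrite tsize_elems -sum1_size leqW // leq_sum.
rewrite -/(s3 2) in le4 *; move: le4 leF; rewrite -[s3 2]/acc.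
have := leq_mul le_l (leqnn (pbound p + tsize x + (tsize l).*2 + M * 3 + 5)).
set A := size _ * _; set C := foldl _ _ _; rewrite -muln2.
set X := tsize l * _ => *; lia.
Qed.

End Fold.

(** * Measuring running times *)

(* The spare variable [N] accumulates a tree whose size dominates the time. *)
Fixpoint trace (N : nat) (p : prog) : prog :=
  let tick := Assign N (ENode ELeaf (EVar N)) in
  match p with
  | Assign i e => Seq (Assign i e) (Assign N (ENode (EVar i) (EVar N)))
  | Seq p q => Seq (trace N p) (trace N q)
  | If e p q => If e (Seq tick (trace N p)) (Seq tick (trace N q))
  | While e p => Seq (While e (Seq (trace N p) tick)) tick
  end.

Lemma eval_eq N e (s S : store) : ebound e <= N ->
  (forall i, i < N -> S i = s i) -> eval S e = eval s e.
Proof.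
move=> He HS; elim: e He => //=.
- by move=> e1 IH1 e2 IH2; rewrite geq_max => /andP[/IH1-> /IH2->].
- by move=> e1 IH /IH->.
- by move=> e1 IH /IH->.
Qed.

(** An assignment costs the size of the tree that it stores, so the trace hangs that very tree on
    the clock; a tick pays for each test. Since [p] mentions only variables below [N], the clock
    does not disturb it. *)
Lemma exec_trace N p s t s' : exec p s t s' -> pbound p <= N ->
  forall S : store, (forall i, i < N -> S i = s i) ->
  exists u S', [/\ exec (trace N p) S u S', forall i, i < N -> S' i = s' i
                 & tsize (S N) + t <= tsize (S' N)].
Proof.
have tick_ok (S : store) : exec (Assign N (ENode ELeaf (EVar N))) S
    (tsize (S N)).+2 (upd S N (Node Leaf (S N))).
  exact: (@exec_assign_to N (ENode ELeaf (EVar N)) S (Node Leaf (S N)) erefl).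
have updN (S : store) y : upd S N y N = y by rewrite /upd eqxx.
have upd_lt (S : store) y i : i < N -> upd S N y i = S i.
  by move=> lti; rewrite /upd; case: eqP => // ?; lia.
elim=> {p s t s'}
  [i e s|p q s s' s'' t u _ IHp _ IHq|e p q s s' t He _ IH|e p q s s' t He _ IH
  |e p s s' s'' t u He _ IHp _ IHw|e p s He] /=; rewrite ?geq_max.
- case/andP=> ltiN leN S HS; set S1 := upd S i (eval s e).
  have S1i : S1 i = eval s e by rewrite /S1 /upd eqxx.
  have S1N : S1 N = S N by rewrite /S1 /upd; case: eqP => // ?; lia.
  have H1 := exec_assign_to i (eval_eq leN HS).
  have H2 := @exec_assign_to N (ENode (EVar i) (EVar N)) S1 _ erefl.
  eexists; eexists; split; first exact: exec_seq H1 H2.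
    by move=> j ltjN; rewrite upd_lt // /S1 /upd HS.
  by rewrite updN /= S1i S1N; lia.
- case/andP=> /IHp{}IHp /IHq{}IHq S /IHp[u1 [S1 [H1 E1 le1]]].
  case: (IHq _ E1) => u2 [S2 [H2 E2 le2]].
  exists (u1 + u2), S2; split=> //; [exact: exec_seq H1 H2 | lia].
- case/and3P=> leN /IH{}IH _ S HS.
  have [|u [S1 [H1 E1 le1]]] := IH (upd S N (Node Leaf (S N))).
    by move=> i lti; rewrite upd_lt ?HS.
  eexists; exists S1; split=> //.
    apply: exec_if_true; first by rewrite (eval_eq leN HS).
    exact: exec_seq (tick_ok S) H1.
  by move: le1; rewrite updN /=; lia.
- case/and3P=> leN _ /IH{}IH S HS.
  have [|u [S1 [H1 E1 le1]]] := IH (upd S N (Node Leaf (S N))).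
    by move=> i lti; rewrite upd_lt ?HS.
  eexists; exists S1; split=> //.
    apply: exec_if_false; first by rewrite (eval_eq leN HS).
    exact: exec_seq (tick_ok S) H1.
  by move: le1; rewrite updN /=; lia.
- case/andP=> leN lepN S HS; have [u1 [S1 [H1 E1 le1]]] := IHp lepN _ HS.
  have [||u2 [S2 [H2 E2 le2]]] := IHw _ (upd S1 N (Node Leaf (S1 N))).
  + by rewrite /= geq_max leN.
  + by move=> i lti; rewrite upd_lt ?E1.
  (* A traced loop is a loop followed by one tick for the failing test; inversion exposes the inner
     loop, in front of which one more iteration is put. *)
  rewrite /= in H2; inversion H2; subst.
  eexists; exists S2; split=> //.
    apply: exec_seq; last by eassumption.
    apply: exec_while_true; first by rewrite (eval_eq leN HS).
      exact: exec_seq H1 (tick_ok S1).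
    by eassumption.
  by move: le2; rewrite updN /=; lia.
- case/andP=> leN _ S HS; eexists; exists (upd S N (Node Leaf (S N))); split.
  + apply: exec_seq (tick_ok S).
    by apply: exec_while_false; rewrite (eval_eq leN HS).
  + by move=> i lti; rewrite upd_lt ?HS.
  + by rewrite updN /=; lia.
Qed.

(** Variable 1 is a worklist: each turn removes one node, dropping a [Leaf] or replacing a [Node] by
    its two children, so the number of turns is the total size of the listed trees. *)
Definition size_loop : prog :=
  While (EVar 1)
    (Seq (If (EHead (EVar 1))
             (Assign 1 (ENode (EHead (EHead (EVar 1)))
                              (ENode (ETail (EHead (EVar 1))) (ETail (EVar 1)))))
             (Assign 1 (ETail (EVar 1))))
         (Assign 0 (ENode ELeaf (EVar 0)))).

Lemma exec_size_loop m : forall (s : store) c,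
  \sum_(a <- elems (s 1)) tsize a = m -> s 0 = code_nat c ->
  exists t s', exec size_loop s t s' /\ s' 0 = code_nat (m + c).
Proof.
elim: m => [|m IH] s c; case E1: (s 1) => [|a l] /=;
  rewrite ?big_nil ?big_cons => // Em E0.
- by exists 1, s; split=> //; apply: exec_while_false; rewrite /= E1.
- by have := tsize_gt0 a; lia.
have [y [y1 [u Hu]]] : exists y, \sum_(a <- elems y) tsize a = m /\
  exists u, exec (If (EHead (EVar 1))
             (Assign 1 (ENode (EHead (EHead (EVar 1)))
                              (ENode (ETail (EHead (EVar 1))) (ETail (EVar 1)))))
             (Assign 1 (ETail (EVar 1)))) s u (upd s 1 y).
  case: a Em E1 => [|a b] /= Em E1.
    exists l; split; first lia.
    eexists; apply: exec_if_false; first by rewrite /= E1.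
    by apply: exec_assign_to; rewrite /= E1.
  exists (Node a (Node b l)); split; first by rewrite /= !big_cons; lia.
  eexists; apply: exec_if_true; first by rewrite /= E1.
  by apply: exec_assign_to; rewrite /= E1.
set s1 := upd s 1 y in Hu.
have H2 := @exec_assign_to 0 (ENode ELeaf (EVar 0)) s1 (code_nat c.+1).
rewrite /= {1}/s1 /upd /= E0 in H2; move/(_ erefl) in H2.
have [t [s' [H3 E3]]] := IH (upd s1 0 (code_nat c.+1)) c.+1 y1 erefl.
eexists; exists s'; split; last by rewrite E3 addnS.
apply: exec_while_true H3; first by rewrite /= E1.
exact: exec_seq Hu H2.
Qed.

Lemma computes_tsize : exists p, forall x, computes p x (code_nat (tsize x)).
Proof.
exists (Seq (Assign 1 (ENode (EVar 0) ELeaf)) (Seq (Assign 0 ELeaf) size_loop)) => x.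
have H1 := @exec_assign_to 1 (ENode (EVar 0) ELeaf) (start x) (Node x Leaf) erefl.
set s1 := upd (start x) 1 _ in H1.
have H2 := @exec_assign_to 0 ELeaf s1 Leaf erefl.
have [|t [s [H3 E3]]] := @exec_size_loop (tsize x) (upd s1 0 Leaf) 0 _ erefl.
  by rewrite /s1 /upd /= big_seq1.
eexists; exists s; last by rewrite E3 addn0.
exact: exec_seq H1 (exec_seq H2 H3).
Qed.

(** The clock starts as the input rather than as [Leaf], so that [n] bounds the input size too and,
    by [computes_in_size], the output size. *)
Lemma computes_clock p : exists q, forall x t y, computes_in p x t y ->
  exists2 n, computes q x (code_nat n) & tsize x + t <= n.
Proof.
have [r Hr] := computes_tsize; set N := (pbound p).+1.
exists (Seq (Assign N (EVar 0)) (Seq (trace N p) (Seq (Assign 0 (EVar N)) (call 0 r)))).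
move=> x t y [s Hs _].
have H1 := @exec_assign_to N (EVar 0) (start x) x erefl.
have [|u [s1 [H2 _ le1]]] := exec_trace Hs (leqnSn _) (S := upd (start x) N x).
  by move=> i lti; rewrite /upd; case: eqP => // ?; rewrite /N in lti *; lia.
have H3 := @exec_assign_to 0 (EVar N) s1 (s1 N) erefl.
have [v Hv] := Hr (s1 N).
have [s2 [H4 E4 _]] := exec_call Hv (erefl : upd s1 0 (s1 N) 0 = s1 N).
exists (tsize (s1 N)); last by move: le1; rewrite {1}/upd eqxx.
eexists; exists s2; last exact: E4.
exact: exec_seq H1 (exec_seq H2 (exec_seq H3 H4)).
Qed.

(** * Polynomial-time functions *)

Definition tree_eq_dec : comparable tree.
Proof. by rewrite /comparable /decidable; decide equality. Defined.

HB.instance Definition _ := hasDecEq.Build tree (compareP tree_eq_dec).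

(** As the base is at least 2, this single form absorbs constants, sums and products. The index type
    is general because the final estimate is in terms of a pair of an instance and a parameter. *)
Definition pbnd (I : Type) (sz T : I -> nat) :=
  exists c, forall i, T i <= (sz i + 2) ^ c.

Lemma leq_exp2 m n e : m <= n -> m ^ e <= n ^ e.
Proof. by case: e => // e; rewrite leq_exp2r. Qed.

Section Pbnd.
Variables (I : Type) (sz : I -> nat).
Notation pb := (pbnd sz).

Lemma pb_le T T' : pb T' -> (forall i, T i <= T' i) -> pb T.
Proof. by move=> [c Hc] le; exists c => i; apply: leq_trans (Hc i). Qed.

Lemma pb_const n : pb (fun=> n).
Proof.
exists n => i; apply: leq_trans (ltnW (ltn_expl n (isT : 1 < 2))) _.
by rewrite leq_exp2 // leq_addl.
Qed.

Lemma pb_size : pb sz.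
Proof. by exists 1 => i; rewrite expn1 leq_addr. Qed.

Lemma pb_mul T T' : pb T -> pb T' -> pb (fun i => T i * T' i).
Proof.
by move=> [c Hc] [c' Hc']; exists (c + c') => i; rewrite expnD leq_mul.
Qed.

Lemma pb_add T T' : pb T -> pb T' -> pb (fun i => T i + T' i).
Proof.
move=> [c Hc] [c' Hc']; exists (c + c').+1 => i.
have gt1 : 1 < sz i + 2 by rewrite addn2.
apply: leq_trans (leq_add (Hc i) (Hc' i)) _.
rewrite expnS; apply: leq_trans (leq_mul gt1 (leqnn _)).
by rewrite mul2n -addnn leq_add // leq_exp2l // ?leq_addr ?leq_addl.
Qed.

Lemma pb_exp T e : pb T -> pb (fun i => T i ^ e).
Proof.
move=> HT; elim: e => [|e IH]; first exact: pb_const.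
by apply: pb_le (pb_mul HT IH) _ => i; rewrite expnS.
Qed.

(** Change of the size measure: transfers a bound in the size of a tree to a bound in the size of
    the data it was built from. *)
Lemma pb_comp J (sz' T : J -> nat) (g : I -> J) :
  pbnd sz' T -> pb (fun i => sz' (g i)) -> pb (fun i => T (g i)).
Proof.
move=> [c Hc] Hg.
by apply: pb_le (pb_exp c (pb_add Hg (pb_const 2))) _ => i; apply: Hc.
Qed.

End Pbnd.

Ltac pbtac := repeat first [ assumption | lazymatch goal with
  | |- pbnd _ (fun=> ?n) => apply: pb_const
  | |- pbnd _ (fun x => _ + _) => apply: pb_add
  | |- pbnd _ (fun x => _ * _) => apply: pb_mul
  | |- pbnd _ (fun x => _ ^ _) => apply: pb_exp
  | |- pbnd ?s ?s => apply: pb_size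
  | |- pbnd ?s (fun x => ?s x) => apply: pb_size
  end ].

Definition poly (f : tree -> tree) :=
  exists2 T, pbnd tsize T & runs (fun=> True) f T.

Lemma poly_ext f g : f =1 g -> poly f -> poly g.
Proof.
move=> fg [T HT [p Hp]]; exists T => //; exists p => x Dx.
by case: (Hp x Dx) => t; rewrite fg; exists t.
Qed.

Lemma poly_size f : poly f -> pbnd tsize (fun x => tsize (f x)).
Proof.
case=> T HT Hf; apply: pb_le (pb_add (pb_size tsize) HT) _ => x.
exact: runs_size Hf I.
Qed.

Lemma poly_expr e : pbnd tsize (fun x => tsize (eval (start x) e)) ->
  poly (fun x => eval (start x) e).
Proof.
move=> He; exists (fun x => tsize (eval (start x) e)) => //.
by have [p Hp] := runs_expr e; exists p => x _; apply: Hp.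
Qed.

Lemma poly_id : poly (fun x => x).
Proof. by apply: (poly_expr (e := EVar 0)); apply: pb_size. Qed.

Lemma poly_comp f g : poly f -> poly g -> poly (fun x => f (g x)).
Proof.
move=> [Tf Pf Hf] Hg; have Pg := poly_size Hg; case: Hg => Tg PTg Hg.
have [|K HK] := runs_comp _ Hf Hg; first by [].
exists (fun x => Tg x + (K + Tf (g x))) => //.
by pbtac; apply: (pb_comp (T := Tf)) Pf Pg.
Qed.

Lemma poly_node f g : poly f -> poly g -> poly (fun x => Node (f x) (g x)).
Proof.
move=> [Tf Pf Hf] [Tg Pg Hg]; have [K HK] := runs_pair Hf Hg.
by eexists; last exact: HK; pbtac.
Qed.

Lemma poly_head f : poly f -> poly (fun x => thead (f x)).
Proof.
move=> Hf; apply: (poly_comp (f := thead)) Hf; apply: (poly_expr (e := EHead (EVar 0))).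
by apply: pb_le (pb_size _) _; case=> //= a b; lia.
Qed.

Lemma poly_tail f : poly f -> poly (fun x => ttail (f x)).
Proof.
move=> Hf; apply: (poly_comp (f := ttail)) Hf; apply: (poly_expr (e := ETail (EVar 0))).
by apply: pb_le (pb_size _) _; case=> //= a b; lia.
Qed.

Lemma poly_const c : poly (fun=> c).
Proof.
elim: c => [|a IHa b IHb]; last exact: poly_node.
by apply: (poly_expr (e := ELeaf)); apply: pb_const.
Qed.

Lemma poly_if (U : Type) (c : U -> tree) b f g :
  poly (fun x => code_bool (b x)) -> poly (fun x => c (f x)) ->
  poly (fun x => c (g x)) -> poly (fun x => c (if b x then f x else g x)).
Proof.
move=> [Tb Pb Hb] [Tf Pf [pf Hf]] [Tg Pg [pg Hg]].
have [||K [p Hp]] := @runs_if _ b (fun x => c (f x)) (fun x => c (g x)) _ Tf Tg Hb.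
- by exists pf => x _; apply: Hf.
- by exists pg => x _; apply: Hg.
exists (fun x => K + tsize x + Tb x + (Tf x + Tg x)); first by pbtac.
exists p => x _; have [t Ht le] := Hp x I; exists t; first by case: (b x) Ht.
by apply: leq_trans le _; case: (b x); lia.
Qed.

Lemma tsize_mem a l : a \in l -> tsize a < tsize (code_seq id l).
Proof.
elim: l => //= b l IH; rewrite inE => /predU1P[->|/IH]; lia.
Qed.

Notation fold_step S x := (fun acc a => S (Node x (Node a acc))).

(** The bound on all intermediate accumulators cannot be derived from the other hypotheses:
    iterating a polynomial-time step may square the size each time. *)
Lemma poly_foldl z l S : poly z -> poly l -> poly S ->
  (exists2 B, pbnd tsize B & forall x i,
     tsize (foldl (fold_step S x) (z x) (take i (elems (l x)))) <= B x) ->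
  poly (fun x => foldl (fold_step S x) (z x) (elems (l x))).
Proof.
move=> Pz Pl [TS [c Hc] [p Hp]] [B PB HB].
(* The 4 counts the two nodes of the argument [Node x (Node a acc)] and the 2 in [pbnd]. *)
pose M x := B x + (tsize x + tsize (l x) + B x + 4) ^ c.
have sl := poly_size Pl; have PM : pbnd tsize M by rewrite /M; pbtac.
have okM x : fold_ok p S x (M x) (z x) (elems (l x)).
  suff gen l' acc : (forall i, tsize (foldl (fold_step S x) acc (take i l')) <= B x) ->
      {subset l' <= elems (l x)} -> fold_ok p S x (M x) acc l' by exact: gen (HB x) _.
  elim: l' acc => [|a l' IH] acc HBx sub /=.
    by split=> //; apply: leq_trans (HBx 0) (leq_addr _ _).
  have leB : tsize acc <= B x by exact: (HBx 0).
  split; first exact: leq_trans leB (leq_addr _ _).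
  split.
    have [t Ht let_] := Hp (Node x (Node a acc)) I; exists t => //.
    apply: leq_trans let_ (leq_trans (Hc _) _); apply: leq_trans (leq_addl _ _).
    apply: leq_exp2 => /=.
    have := tsize_mem (sub a (mem_head _ _)); rewrite code_elems; lia.
  apply: IH => [i|b bl]; first exact: (HBx i.+1).
  by apply: sub; rewrite inE bl orbT.
have [TX PX HX] : poly (fun x => Node x (Node (z x) (l x))).
  by do 2?[apply: poly_node] => //; apply: poly_id.
(* The bound [M x] is known only for the accumulator and the list computed from [x], so the fold
   program is used on these triples alone. *)
pose Dy y := exists x, y = Node x (Node (z x) (l x)).
pose Ty y := let L := tsize (ttail (ttail y)) in
  L * (pbound p + tsize (thead y) + L * 2 + M (thead y) * 3 + 5) + 1
           + tsize (thead y) + L + M (thead y) * 2.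
have HF : runs Dy (fun y => foldl (fold_step S (thead y)) (thead (ttail y))
    (elems (ttail (ttail y)))) Ty.
  by exists (fold_prog p) => _ [x ->]; exact: computes_fold (okM x).
have [|K HK] := runs_comp _ HF HX; first by move=> x _; exists x.
eexists; last exact: HK.
by rewrite /Ty /=; pbtac.
Qed.

(** A total left inverse of [code_nat]. On the code of a list it is the length, hence on an
    adjacency matrix the number of vertices. *)
Definition tn (x : tree) := size (elems x).

Lemma code_natE n : code_nat n = code_seq id (nseq n Leaf).
Proof. by elim: n => //= n ->. Qed.

Lemma tn_code n : tn (code_nat n) = n.
Proof. by rewrite /tn code_natE elems_code size_map size_nseq. Qed.

Lemma elems_id l : elems (code_seq id l) = l.
Proof. by rewrite elems_code map_id. Qed.

Lemma code_seq_map (T : Type) (c : T -> tree) l : code_seq c l = code_seq id (map c l).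
Proof. by rewrite /code_seq foldr_map. Qed.

Lemma tsize_code_seq (T : Type) (c : T -> tree) l :
  tsize (code_seq c l) = (\sum_(a <- l) (tsize (c a)).+1).+1.
Proof. by rewrite tsize_elems elems_code big_map. Qed.

Lemma leq_sum_seq (T : eqType) (r : seq T) (F : T -> nat) K :
  (forall a, a \in r -> F a <= K) -> \sum_(a <- r) F a <= size r * K.
Proof.
elim: r => [|a r IH] HF; rewrite ?big_nil // big_cons mulSn leq_add //.
  exact/HF/mem_head.
by apply: IH => b br; apply: HF; rewrite inE br orbT.
Qed.

(** Consing results onto the accumulator reverses their order; this one fold then yields reversal,
    map and concatenation. *)
Lemma poly_mapcatrev z l s : poly z -> poly l -> poly s ->
  poly (fun x => code_seq id
     (catrev [seq s (Node x a) | a <- elems (l x)] (elems (z x)))).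
Proof.
move=> Pz Pl Ps; pose S y := Node (s (Node (thead y) (thead (ttail y)))) (ttail (ttail y)).
have foldE x l' z' : foldl (fold_step S x) z' l' =
    code_seq id (catrev [seq s (Node x a) | a <- l'] (elems z')).
  by elim: l' z' => [|a l' IH] z' /=; rewrite ?code_elems // IH.
have PS : poly S.
  apply: poly_node; last by do !apply: poly_tail; apply: poly_id.
  apply: (poly_comp Ps); apply: poly_node; apply: poly_head; first exact: poly_id.
  by apply: poly_tail; apply: poly_id.
apply: poly_ext (poly_foldl Pz Pl PS _) => [x|]; first exact: foldE.
have [c Hc] := poly_size Ps; have sl := poly_size Pl; have sz := poly_size Pz.
exists (fun x => tsize (z x) + tsize (l x) * ((tsize x + tsize (l x) + 3) ^ c + 1)).
  by pbtac.
move=> x i; rewrite foldE catrevE tsize_code_seq big_cat /= big_rev /= -addSn addnC.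
rewrite addnS -addSn -tsize_elems leq_add2l big_map.
pose F a := (tsize (s (Node x a))).+1.
have: \sum_(a <- take i (elems (l x))) F a <= \sum_(a <- elems (l x)) F a.
  by rewrite -{2}(cat_take_drop i (elems (l x))) big_cat leq_addr.
move/leq_trans; apply; set E := (_ ^ c).
have le_l : size (elems (l x)) <= tsize (l x).
  by rewrite tsize_elems -sum1_size leqW // leq_sum.
apply: leq_trans (leq_mul le_l (leqnn (E + 1))).
apply: leq_sum_seq => a al; rewrite /F addn1 ltnS.
apply: leq_trans (Hc _) (leq_exp2 _ _) => /=.
by have := tsize_mem al; rewrite code_elems; lia.
Qed.

Lemma poly_rev l : poly (fun x => code_seq id (l x)) ->
  poly (fun x => code_seq id (rev (l x))).
Proof.
move=> Pl; apply: poly_ext (poly_mapcatrev (poly_const Leaf) Pl (poly_tail poly_id)) => x.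
by rewrite elems_id /= map_id.
Qed.

(* Expressions with free variables are functions of an environment; the body of
   a loop over [a], in the environment [x], is evaluated in [Node x a]. *)
Lemma poly_map (U : Type) (c : U -> tree) (l : tree -> seq tree) (s : tree -> tree -> U) :
  poly (fun x => code_seq id (l x)) ->
  poly (fun y => c (s (thead y) (ttail y))) ->
  poly (fun x => code_seq c [seq s x a | a <- l x]).
Proof.
move=> Pl Ps.
have: poly (fun x => code_seq id (rev [seq c (s x a) | a <- l x])).
  apply: poly_ext (poly_mapcatrev (poly_const Leaf) Pl Ps) => x.
  by rewrite elems_id catrevE cats0.
by move/poly_rev; apply: poly_ext => x; rewrite revK map_comp -code_seq_map.
Qed.

Lemma poly_catrev l l' : poly (fun x => code_seq id (l x)) ->
  poly (fun x => code_seq id (l' x)) ->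
  poly (fun x => code_seq id (catrev (l x) (l' x))).
Proof.
move=> Pl Pl'; apply: poly_ext (poly_mapcatrev Pl' Pl (poly_tail poly_id)) => x.
by rewrite !elems_id /= map_id.
Qed.

Lemma poly_cat (U : Type) (c : U -> tree) l l' :
  poly (fun x => code_seq c (l x)) -> poly (fun x => code_seq c (l' x)) ->
  poly (fun x => code_seq c (l x ++ l' x)).
Proof.
move=> Pl Pl'; have Pm: poly (fun x => code_seq id (map c (l x))).
  by apply: poly_ext Pl => x; rewrite -code_seq_map.
have Pm': poly (fun x => code_seq id (map c (l' x))).
  by apply: poly_ext Pl' => x; rewrite -code_seq_map.
apply: poly_ext (poly_catrev (poly_rev Pm) Pm') => x.
by rewrite catrevE revK -map_cat -code_seq_map.
Qed.

Lemma poly_elems f : poly f -> poly (fun x => code_seq id (elems (f x))).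
Proof. by apply: poly_ext => x; rewrite code_elems. Qed.

Lemma poly_flatten (U : Type) (c : U -> tree) (l : tree -> seq (seq U)) :
  poly (fun x => code_seq (code_seq c) (l x)) ->
  poly (fun x => code_seq c (flatten (l x))).
Proof.
move=> Pl.
pose S y := code_seq id (catrev (elems (thead (ttail y))) (elems (ttail (ttail y)))).
have PS : poly S.
  by apply: poly_catrev; apply: poly_elems; [apply: poly_head|apply: poly_tail];
    apply: poly_tail; apply: poly_id.
have foldE x l' z' : foldl (fold_step S x) (code_seq id z') l' =
    code_seq id (catrev (flatten (map elems l')) z').
  by elim: l' z' => //= a l' IH z'; rewrite /S /= elems_id IH !catrevE rev_cat -catA.
have := poly_foldl (poly_const Leaf) Pl PS.
case=> [|T HT HF].
  exists (fun x => tsize (code_seq (code_seq c) (l x))); first exact: poly_size.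
  move=> x i; rewrite (foldE x _ [::]) catrevE cats0 tsize_code_seq big_rev /=.
  rewrite -[X in X <= _]/(_.+1) big_flatten big_map tsize_elems ltnS.
  rewrite -{2}(cat_take_drop i (elems _)) big_cat; apply: leq_trans _ (leq_addr _ _).
  by apply: leq_sum => a _; rewrite (tsize_elems a) ltnW // ltnS ltnW.
have: poly (fun x => code_seq id (rev (map c (flatten (l x))))).
  apply: poly_ext (ex_intro2 _ _ T HT HF) => x; rewrite (foldE x _ [::]).
  rewrite catrevE cats0 elems_code -map_comp map_flatten.
  by congr (code_seq id (rev (flatten _))); apply: eq_map => a /=; rewrite elems_code.
by move/poly_rev; apply: poly_ext => x; rewrite revK -code_seq_map.
Qed.

Lemma poly_tn f : poly f -> poly (fun x => code_nat (tn (f x))).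
Proof.
move=> Pf; have := poly_map (c := id) (s := fun _ _ => Leaf) (poly_elems Pf) (poly_const Leaf).
apply: poly_ext.
by move=> x; rewrite code_natE /tn; elim: (elems _) => //= a l ->.
Qed.

Lemma poly_seqsize (U : Type) (c : U -> tree) (l : tree -> seq U) :
  poly (fun x => code_seq c (l x)) -> poly (fun x => code_nat (size (l x))).
Proof.
by move/poly_tn; apply: poly_ext => x; rewrite /tn elems_code size_map.
Qed.

Lemma poly_add m n : poly (fun x => code_nat (m x)) -> poly (fun x => code_nat (n x)) ->
  poly (fun x => code_nat (m x + n x)).
Proof.
move=> Pm Pn; apply: poly_ext (poly_cat (c := id) (l := fun x => nseq (m x) Leaf)
  (l' := fun x => nseq (n x) Leaf) _ _) => [x||]; first by rewrite -nseqD -code_natE.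
- by apply: poly_ext Pm => x; rewrite code_natE.
- by apply: poly_ext Pn => x; rewrite code_natE.
Qed.

Lemma poly_mul m n : poly (fun x => code_nat (m x)) -> poly (fun x => code_nat (n x)) ->
  poly (fun x => code_nat (m x * n x)).
Proof.
move=> Pm Pn.
have Pnn: poly (fun x => code_seq (code_seq id)
    [seq nseq (n x) Leaf | _ <- nseq (m x) Leaf]).
  apply: (poly_map (s := fun x _ => nseq (n x) Leaf)).
    by apply: poly_ext Pm => x; rewrite code_natE.
  by apply: poly_ext (poly_comp Pn (poly_head poly_id)) => x; rewrite code_natE.
apply: poly_ext (poly_seqsize (poly_flatten Pnn)) => x.
rewrite size_flatten /shape -map_comp; congr code_nat.
by elim: (m x) => //= k ->; rewrite size_nseq.
Qed.

Lemma take_nseq_min (T : Type) i j (x : T) : take i (nseq j x) = nseq (minn i j) x.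
Proof. by elim: i j => [|i IH] [|j] //=; rewrite IH minnSS. Qed.

(** A unary number is itself a list to loop over; each turn takes one tail. *)
Lemma poly_drop l n : poly l -> poly (fun x => code_nat (n x)) ->
  poly (fun x => code_seq id (drop (n x) (elems (l x)))).
Proof.
move=> Pl Pn; pose S y := ttail (ttail (ttail y)).
have PS : poly S by do !apply: poly_tail; apply: poly_id.
have foldE x k z : foldl (fold_step S x) z (nseq k Leaf) = code_seq id (drop k (elems z)).
  elim: k z => [|k IH] z /=; first by rewrite drop0 code_elems.
  by rewrite IH /S /=; case: z.
apply: poly_ext (poly_foldl Pl Pn PS _) => [x|].
  by rewrite code_natE elems_id foldE.
exists (fun x => tsize (l x)); first exact: poly_size.
move=> x i; rewrite code_natE elems_id.
rewrite take_nseq_min.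
rewrite foldE tsize_code_seq tsize_elems ltnS.
by rewrite -{2}(cat_take_drop (minn i (n x)) (elems (l x))) big_cat leq_addl.
Qed.

Lemma poly_nth l n : poly l -> poly (fun x => code_nat (n x)) ->
  poly (fun x => nth Leaf (elems (l x)) (n x)).
Proof.
move=> Pl Pn; apply: poly_ext (poly_head (poly_drop Pl Pn)) => x.
rewrite -[n x in RHS]addn0 -nth_drop; by case: (drop _ _).
Qed.

Lemma poly_is_node f : poly f -> poly (fun x => code_bool (is_node (f x))).
Proof.
move=> Pf; pose S (y : tree) := Node Leaf Leaf.
have PS : poly S by apply: poly_const.
have Pz := poly_const Leaf.
apply: poly_ext (poly_foldl Pz Pf PS _) => [x|].
  by case: (f x) => //= a y; elim: y a.
exists (fun=> 3); first exact: pb_const.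
by move=> x i; elim/last_ind: (take _ _) => // l a _; rewrite foldl_rcons.
Qed.

Lemma poly_not b : poly (fun x => code_bool (b x)) -> poly (fun x => code_bool (~~ b x)).
Proof.
move=> Pb.
apply: poly_ext (poly_if (c := code_bool) (f := fun=> false) (g := fun=> true) Pb _ _).
- by move=> x; case: (b x).
- exact: poly_const.
- exact: poly_const.
Qed.

Lemma poly_and b b' : poly (fun x => code_bool (b x)) -> poly (fun x => code_bool (b' x)) ->
  poly (fun x => code_bool (b x && b' x)).
Proof.
move=> Pb Pb'; exact: (poly_if (c := code_bool) (g := fun=> false) Pb Pb' (poly_const _)).
Qed.

Lemma poly_or b b' : poly (fun x => code_bool (b x)) -> poly (fun x => code_bool (b' x)) ->
  poly (fun x => code_bool (b x || b' x)).
Proof.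
move=> Pb Pb'; exact: (poly_if (c := code_bool) (f := fun=> true) Pb (poly_const _) Pb').
Qed.

Lemma poly_leq m n : poly (fun x => code_nat (m x)) -> poly (fun x => code_nat (n x)) ->
  poly (fun x => code_bool (m x <= n x)).
Proof.
move=> Pm Pn; apply: poly_ext (poly_not (poly_is_node (poly_drop Pm Pn))) => x.
rewrite code_natE elems_id drop_nseq -subn_eq0.
by case: (m x - n x).
Qed.

Lemma poly_eqn m n : poly (fun x => code_nat (m x)) -> poly (fun x => code_nat (n x)) ->
  poly (fun x => code_bool (m x == n x)).
Proof.
move=> Pm Pn; apply: poly_ext (poly_and (poly_leq Pm Pn) (poly_leq Pn Pm)) => x.
by rewrite -eqn_leq.
Qed.

(** The counterexamples are collected, and the resulting list is tested for emptiness. *)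
Lemma poly_all (b : tree -> tree -> bool) l :
  poly (fun x => code_seq id (l x)) ->
  poly (fun y => code_bool (b (thead y) (ttail y))) ->
  poly (fun x => code_bool (all (b x) (l x))).
Proof.
move=> Pl Pb.
have Pf : poly (fun x => code_seq id [seq a <- l x | ~~ b x a]).
  have: poly (fun x => code_seq (code_seq id) [seq if b x a then [::] else [:: a] | a <- l x]).
    apply: (poly_map (s := fun x a => if b x a then [::] else [:: a]) Pl).
    apply: poly_if => //; first exact: poly_const.
    by apply: poly_node; [apply: poly_tail; apply: poly_id | apply: poly_const].
  move/poly_flatten; apply: poly_ext => x; congr code_seq.
  by elim: (l x) => //= a l' ->; case: (b x a).
apply: poly_ext (poly_not (poly_is_node Pf)) => x; congr code_bool.
by elim: (l x) => //= a l1 IH; case: (b x a).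
Qed.

Lemma poly_filter (b : tree -> tree -> bool) l :
  poly (fun x => code_seq id (l x)) ->
  poly (fun y => code_bool (b (thead y) (ttail y))) ->
  poly (fun x => code_seq id [seq a <- l x | b x a]).
Proof.
move=> Pl Pb.
have: poly (fun x => code_seq (code_seq id) [seq if b x a then [:: a] else [::] | a <- l x]).
  apply: (poly_map (s := fun x a => if b x a then [:: a] else [::]) Pl).
  apply: poly_if => //; last exact: poly_const.
  by apply: poly_node; [apply: poly_tail; apply: poly_id | apply: poly_const].
move/poly_flatten; apply: poly_ext => x; congr code_seq.
by elim: (l x) => //= a l' ->; case: (b x a).
Qed.

Lemma poly_iota n : poly (fun x => code_nat (n x)) ->
  poly (fun x => code_seq code_nat (iota 0 (n x))).
Proof.
(* The length of the accumulator is the next number to be consed, so no separate counter is kept. *)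
move=> Pn; pose S y := let acc := ttail (ttail y) in Node (code_nat (tn acc)) acc.
have PS : poly S.
  by apply: poly_node; [apply: poly_tn|]; do !apply: poly_tail; apply: poly_id.
have foldE x k : foldl (fold_step S x) Leaf (nseq k Leaf) =
    code_seq id (rev (map code_nat (iota 0 k))).
  elim: k => // k IH; rewrite -addn1 nseqD foldl_cat IH iotaD map_cat rev_cat /=.
  by rewrite /S /= /tn elems_id size_rev size_map size_iota add0n.
have: poly (fun x => code_seq id (rev (map code_nat (iota 0 (n x))))).
  apply: poly_ext (poly_foldl (poly_const Leaf) Pn PS _) => [x|].
    by rewrite code_natE elems_id foldE.
  have sn := poly_size Pn.
  exists (fun x => (tsize (code_nat (n x)) * (tsize (code_nat (n x)) + 1)).+1).
    apply: pb_le (_ : pbnd _ (fun x => 1 + _)) _; last first.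
      by move=> x; rewrite add1n; apply: leqnn.
    by pbtac.
  move=> x i; rewrite code_natE elems_id.
  rewrite take_nseq_min.
  rewrite foldE tsize_code_seq big_rev big_map ltnS.
  have tsn k : tsize (code_seq id (nseq k Leaf)) = (k * 2).+1.
    by rewrite -code_natE; elim: k => //= k ->; lia.
  rewrite tsn; set q := minn _ _; have leq_ : q <= n x by apply: geq_minr.
  apply: leq_trans (_ : q * (n x * 2).+2 <= _); last by nia.
  rewrite -[q in q * _](size_iota 0); apply: leq_sum_seq => a.
  by rewrite mem_iota code_natE tsn; lia.
by move/poly_rev; apply: poly_ext => x; rewrite revK -code_seq_map.
Qed.

Lemma poly_mapn (U : Type) (c : U -> tree) n (s : tree -> nat -> U) :
  poly (fun x => code_nat (n x)) ->
  poly (fun y => c (s (thead y) (tn (ttail y)))) ->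
  poly (fun x => code_seq c [seq s x i | i <- iota 0 (n x)]).
Proof.
move=> /poly_iota Pn Ps.
apply: poly_ext (poly_map (l := fun x => map code_nat (iota 0 (n x)))
  (s := fun x a => s x (tn a)) _ Ps) => [x|].
  by rewrite -map_comp; congr code_seq; apply: eq_map => i /=; rewrite tn_code.
by apply: poly_ext Pn => x; rewrite -code_seq_map.
Qed.

Lemma poly_alln n (b : tree -> nat -> bool) :
  poly (fun x => code_nat (n x)) ->
  poly (fun y => code_bool (b (thead y) (tn (ttail y)))) ->
  poly (fun x => code_bool (all (b x) (iota 0 (n x)))).
Proof.
move=> /poly_iota Pn Pb.
apply: poly_ext (poly_all (l := fun x => map code_nat (iota 0 (n x)))
  (b := fun x a => b x (tn a)) _ Pb) => [x|].
  by rewrite all_map; congr code_bool; apply: eq_all => i /=; rewrite tn_code.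
by apply: poly_ext Pn => x; rewrite -code_seq_map.
Qed.

Lemma poly_filtern n (b : tree -> nat -> bool) :
  poly (fun x => code_nat (n x)) ->
  poly (fun y => code_bool (b (thead y) (tn (ttail y)))) ->
  poly (fun x => code_seq code_nat [seq i <- iota 0 (n x) | b x i]).
Proof.
move=> /poly_iota Pn Pb.
apply: poly_ext (poly_filter (l := fun x => map code_nat (iota 0 (n x)))
  (b := fun x a => b x (tn a)) _ Pb) => [x|].
  rewrite filter_map -code_seq_map; congr code_seq; apply: eq_filter => i /=.
  by rewrite tn_code.
by apply: poly_ext Pn => x; rewrite -code_seq_map.
Qed.

Lemma poly_succ n : poly (fun x => code_nat (n x)) -> poly (fun x => code_nat (n x).+1).
Proof.
by move=> Pn; apply: poly_ext (poly_add Pn (poly_const (code_nat 1))) => x; rewrite addn1.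
Qed.

Lemma poly_mapfiltern (U : Type) (c : U -> tree) n (b : tree -> nat -> bool)
    (s : tree -> nat -> U) :
  poly (fun x => code_nat (n x)) ->
  poly (fun y => code_bool (b (thead y) (tn (ttail y)))) ->
  poly (fun y => c (s (thead y) (tn (ttail y)))) ->
  poly (fun x => code_seq c [seq s x i | i <- iota 0 (n x) & b x i]).
Proof.
move=> Pn Pb Ps.
apply: poly_ext (poly_map (l := fun x => [seq code_nat i | i <- iota 0 (n x) & b x i])
  (s := fun x a => s x (tn a)) _ Ps) => [x|].
  by rewrite -map_comp; congr code_seq; apply: eq_map => i /=; rewrite tn_code.
by apply: poly_ext (poly_filtern Pn Pb) => x; rewrite -code_seq_map.
Qed.

(** Syntax-directed: the head of the expression selects the rule, and a hypothesis about a free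
    function is composed with the projection that reads its environment inside nested loops. *)
Ltac poly_step :=
  cbv beta; first [ assumption | exact: poly_id | lazymatch goal with
  | |- poly (fun=> ?c) => apply: poly_const
  | |- poly Defs.thead => exact: (poly_head poly_id)
  | |- poly Defs.ttail => exact: (poly_tail poly_id)
  | H : poly (fun x => code_nat (?n x)) |- poly (fun x => code_nat (?n _)) =>
      apply: (poly_comp H)
  | H : poly (fun x => code_seq id (?l x)) |- poly (fun x => code_seq id (?l _)) =>
      apply: (poly_comp H)
  | H : poly ?f |- poly (fun x => ?f _) => apply: (poly_comp H)
  | |- poly (fun x => Node _ _) => apply: poly_node
  | |- poly (fun x => thead _) => apply: poly_head
  | |- poly (fun x => ttail _) => apply: poly_tail
  | |- poly (fun x => code_nat (tn _)) => apply: poly_tn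
  | |- poly (fun x => code_nat (size (elems _))) => apply: poly_tn
  | |- poly (fun x => code_nat (size _)) => apply: poly_seqsize
  | |- poly (fun x => code_nat (_ + _)) => apply: poly_add
  | |- poly (fun x => code_nat (_ * _)) => apply: poly_mul
  | |- poly (fun x => code_nat (_.+1)) => apply: poly_succ
  | |- poly (fun x => code_bool (is_node _)) => apply: poly_is_node
  | |- poly (fun x => code_bool (~~ _)) => apply: poly_not
  | |- poly (fun x => code_bool (_ && _)) => apply: poly_and
  | |- poly (fun x => code_bool (_ || _)) => apply: poly_or
  | |- poly (fun x => code_bool (_ == _)) => apply: poly_eqn
  | |- poly (fun x => code_bool (_ <= _)) => apply: poly_leq
  | |- poly (fun x => code_bool (all _ (iota 0 _))) => apply: poly_alln
  | |- poly (fun x => code_bool (all _ (elems _))) => apply: poly_all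
  | |- poly (fun x => nth Leaf (elems _) _) => apply: poly_nth
  | |- poly (fun x => code_seq _ (iota 0 _)) => apply: poly_iota
  | |- poly (fun x => code_seq _ (elems _)) => apply: poly_elems
  | |- poly (fun x => code_seq _ [seq _ | _ <- iota 0 _ & _]) => apply: poly_mapfiltern
  | |- poly (fun x => code_seq _ [seq _ | _ <- iota 0 _]) => apply: poly_mapn
  | |- poly (fun x => code_seq _ [seq _ | _ <- elems _]) => apply: poly_map
  | |- poly (fun x => code_seq _ [seq _ <- iota 0 _ | _]) => apply: poly_filtern
  | |- poly (fun x => code_seq _ [seq _ <- elems _ | _]) => apply: poly_filter
  | |- poly (fun x => code_seq _ (flatten _)) => apply: poly_flatten
  | |- poly (fun x => code_seq _ (_ ++ _)) => apply: poly_cat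
  | |- poly (fun x => code_seq _ (_ :: _)) => apply: poly_node
  | |- poly (fun x => _ (if _ then _ else _)) => apply: poly_if
  end ].
Ltac polytac := repeat poly_step.

Lemma poly_exp n e : poly (fun x => code_nat (n x)) -> poly (fun x => code_nat (n x ^ e)).
Proof.
move=> Pn; elim: e => [|e IH]; first exact: (poly_const (code_nat 1)).
by apply: poly_ext (poly_mul Pn IH) => x; rewrite expnS.
Qed.

(** * Computable functions without a time bound *)

Definition tot_on (D : pred tree) (f : tree -> tree) :=
  exists p, forall x, D x -> computes p x (f x).
Notation tot := (tot_on predT).

(** The time function comes from choice and need not be computable; it only serves to reuse the
    timed combinators. *)
Lemma tot_runs (D : pred tree) f : tot_on D f -> exists T, runs D f T.
Proof.
case=> p Hp.
have [T HT] : exists T : tree -> nat, forall x, D x -> computes_in p x (T x) (f x).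
  apply: (functional_choice (fun x t => D x -> computes_in p x t (f x))) => x.
  by case: (boolP (D x)) => [/Hp[t]|_]; [exists t | exists 0].
by exists T, p => x /HT; exists (T x).
Qed.

Lemma runs_tot (D : pred tree) f T : runs D f T -> tot_on D f.
Proof. by case=> p Hp; exists p => x /Hp[t]; exists t. Qed.

Lemma poly_tot f : poly f -> tot f.
Proof. by case=> T _ [p Hp]; exists p => x _; have [t] := Hp x I; exists t. Qed.

Lemma tot_ext f g : f =1 g -> tot f -> tot g.
Proof. by move=> fg [p Hp]; exists p => x Dx; rewrite -fg; apply: Hp. Qed.

Lemma tot_comp (D D' : pred tree) f g : (forall x, D x -> D' (g x)) ->
  tot_on D' f -> tot_on D g -> tot_on D (fun x => f (g x)).
Proof.
move=> DD' /tot_runs[Tf Hf] /tot_runs[Tg Hg].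
by have [K /runs_tot] := runs_comp DD' Hf Hg.
Qed.

Lemma tot_node (D : pred tree) f g : tot_on D f -> tot_on D g ->
  tot_on D (fun x => Node (f x) (g x)).
Proof.
by move=> /tot_runs[Tf Hf] /tot_runs[Tg Hg]; have [K /runs_tot] := runs_pair Hf Hg.
Qed.

Lemma tot_if (b : pred tree) f g : tot (fun x => code_bool (b x)) ->
  tot_on b f -> tot g -> tot (fun x => if b x then f x else g x).
Proof.
move=> /tot_runs[Tb Hb] /tot_runs[Tf [pf Hf]] /tot_runs[Tg [pg Hg]].
have [||K] := @runs_if _ b f g Tb Tf Tg Hb.
- by exists pf => x [_]; apply: Hf.
- by exists pg => x _; apply: Hg.
exact: runs_tot.
Qed.

Lemma fold_ok_le p S x M M' acc l : M <= M' -> fold_ok p S x M acc l ->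
  fold_ok p S x M' acc l.
Proof.
move=> leM; elim: l acc => [|a l IH] acc /= [le1]; first by rewrite (leq_trans le1).
case=> [[t Ht le2]] /IH ok; split; first exact: leq_trans leM.
by split=> //; exists t => //; apply: leq_trans leM.
Qed.

(** In contrast to the polynomial fold, growth is unrestricted: for each input, finitely many
    halting steps have some common bound [M]. *)
Lemma tot_foldl z l S : tot z -> tot l -> tot S ->
  tot (fun x => foldl (fold_step S x) (z x) (elems (l x))).
Proof.
move=> Tz Tl [p Hp].
have ok x acc l' : exists M, fold_ok p S x M acc l'.
  elim: l' acc => [|a l' IH] acc; first by exists (tsize acc).
  have [M HM] := IH (S (Node x (Node a acc))).
  have [t Ht] := Hp (Node x (Node a acc)) isT.
  exists (maxn (tsize acc) (maxn t M)) => /=; split; first exact: leq_maxl.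
  split; first by exists t => //; rewrite !leq_max leqnn orbT.
  by apply: fold_ok_le HM; rewrite !leq_max leqnn !orbT.
pose D y := is_node y && is_node (ttail y).
pose F y := foldl (fold_step S (thead y)) (thead (ttail y)) (elems (ttail (ttail y))).
apply: (@tot_comp predT D F (fun x => Node x (Node (z x) (l x)))) => //.
  exists (fold_prog p); case=> // x [] // acc l' _.
  by have [M /computes_fold[t]] := ok x acc (elems l'); exists t.
by do !apply: tot_node => //; apply: poly_tot; apply: poly_id.
Qed.

(** * Circuits *)

Section NodeValues.
Variables (A : Type) (d : A) (rule : seq A -> gate -> A).
Hypothesis rule_args : forall vs vs' g,
  {in gate_args g, forall a, nth d vs a = nth d vs' a} -> rule vs g = rule vs' g.

Lemma node_values_prefix init gs : exists suf, node_values rule init gs = init ++ suf.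
Proof.
elim: gs init => [|g gs IH] init; first by exists [::]; rewrite cats0.
have [suf /= ->] := IH (rcons init (rule init g)).
by exists (rule init g :: suf); rewrite cat_rcons.
Qed.

Lemma size_node_values init gs : size (node_values rule init gs) = size init + size gs.
Proof.
by elim: gs init => [|g gs IH] init /=; rewrite ?addn0 // IH size_rcons addSnnS.
Qed.

Lemma nth_node_values_input init gs i : i < size init ->
  nth d (node_values rule init gs) i = nth d init i.
Proof. by case: (node_values_prefix init gs) => suf -> lti; rewrite nth_cat lti. Qed.

(** A gate was evaluated on the prefix of values known at its turn; as its arguments lie in that
    prefix, it may be evaluated on the final list instead. Stated for any rule, to serve both truth
    values and path maxima. *)
Lemma nth_node_values init gs g0 i : i < size gs ->
  all (fun a => a < size init + i) (gate_args (nth g0 gs i)) ->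
  nth d (node_values rule init gs) (size init + i) =
    rule (node_values rule init gs) (nth g0 gs i).
Proof.
move=> lti; set g := nth g0 gs i => args_lt.
pose V1 := node_values rule init (take i gs).
have sz1 : size V1 = size init + i by rewrite size_node_values size_take lti.
have [suf ->] : exists suf, node_values rule init gs = V1 ++ rule V1 g :: suf.
  rewrite -(cat_take_drop i gs) (drop_nth g0 lti) /node_values foldl_cat /=.
  have [suf] := node_values_prefix (rcons V1 (rule V1 g)) (drop i.+1 gs).
  by rewrite cat_rcons => H; exists suf.
rewrite nth_cat sz1 ltnn subnn /=; apply: rule_args => a ga.
by rewrite nth_cat sz1 (allP args_lt).
Qed.

End NodeValues.

Lemma gate_value_args vs vs' g :
  {in gate_args g, forall a, nth false vs a = nth false vs' a} ->
  gate_value vs g = gate_value vs' g.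
Proof.
case: g => [a|l|l] /= H; first by rewrite H ?mem_head.
  exact: eq_in_all.
exact: eq_in_has.
Qed.

Lemma path_max_args (a : pred gate) vs vs' g :
  {in gate_args g, forall j, nth 0 vs j = nth 0 vs' j} ->
  a g + \max_(j <- gate_args g) nth 0 vs j = a g + \max_(j <- gate_args g) nth 0 vs' j.
Proof.
by move=> H; congr (_ + _); rewrite big_seq [RHS]big_seq; apply: eq_bigr.
Qed.

(** All N * N conjunctions of two inputs are present, so that the gate for inputs [a] and [b] has
    the number [N + (a * N + b)], whatever the clauses are. *)
Definition clause_circuit (N : nat) (cl : seq (seq nat)) : circuit :=
  Circuit N
    (flatten [seq [seq And [:: a; b] | b <- iota 0 N] | a <- iota 0 N] ++
     map Or cl ++ [:: And [seq N + N * N + i | i <- iota 0 (size cl)]])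
    (N + N * N + size cl).

Section ClauseCircuit.
Variables (N : nat) (cl : seq (seq nat)).
Hypothesis cl_wf : forall c, c \in cl -> forall g, g \in c ->
  exists a b, [/\ a < N, b < N & g = N + (a * N + b)].

Let C := clause_circuit N cl.
Let pairs := flatten [seq [seq And [:: a; b] | b <- iota 0 N] | a <- iota 0 N].

Lemma size_pairs : size pairs = N * N.
Proof.
rewrite size_flatten /shape -map_comp.
transitivity (sumn (nseq N N)); last by rewrite sumn_nseq.
congr sumn; apply: (@eq_from_nth _ 0) => [|i]; rewrite size_map size_iota ?size_nseq //.
by move=> lti; rewrite (nth_map 0) ?size_iota //= size_map size_iota nth_nseq lti.
Qed.

Lemma nth_pairs g0 a b : a < N -> b < N -> nth g0 pairs (a * N + b) = And [:: a; b].
Proof.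
move=> ltaN ltbN; rewrite /pairs.
suff gen q r s : r <= s -> s < r + q ->
    nth g0 (flatten [seq [seq And [:: a; b] | b <- iota 0 N] | a <- iota r q])
      ((s - r) * N + b) = And [:: s; b].
  by have := gen N 0 a; rewrite subn0; apply.
elim: q r => [|q IH] r /= ler lts; first lia.
rewrite nth_cat size_map size_iota.
move: ler; rewrite leq_eqVlt => /predU1P[<-|ltrs].
  by rewrite subnn add0n ltbN (nth_map 0) ?size_iota // nth_iota.
have ->: (s - r) * N + b = N + ((s - r.+1) * N + b).
  by rewrite addnA -mulSn subnSK.
by rewrite ltnNge leq_addr addKn IH //; lia.
Qed.

Lemma gatesE : gates C =
  pairs ++ map Or cl ++ [:: And [seq N + N * N + i | i <- iota 0 (size cl)]].
Proof. by []. Qed.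

Lemma size_gates : size (gates C) = N * N + (size cl).+1.
Proof. by rewrite gatesE !size_cat size_pairs size_map /= addn1. Qed.

Lemma nth_gates_pair g0 a b : a < N -> b < N ->
  nth g0 (gates C) (a * N + b) = And [:: a; b].
Proof.
move=> ltaN ltbN; rewrite gatesE nth_cat size_pairs.
have ->: a * N + b < N * N by nia.
exact: nth_pairs.
Qed.

Lemma nth_gates_or g0 i : i < size cl ->
  nth g0 (gates C) (N * N + i) = Or (nth [::] cl i).
Proof.
move=> lti; rewrite gatesE nth_cat size_pairs ltnNge leq_addr addKn nth_cat size_map lti.
by rewrite (nth_map [::]).
Qed.

Lemma nth_gates_out g0 :
  nth g0 (gates C) (N * N + size cl) = And [seq N + N * N + i | i <- iota 0 (size cl)].
Proof.
by rewrite gatesE nth_cat size_pairs ltnNge leq_addr addKn nth_cat size_map ltnn subnn.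
Qed.

Lemma gate_cases i : i < size (gates C) ->
  [\/ exists a b, [/\ a < N, b < N & i = a * N + b],
      exists2 j, j < size cl & i = N * N + j
    | i = N * N + size cl].
Proof.
rewrite size_gates => lti.
have [ltN|geN] := ltnP i (N * N).
  have N_gt0 : 0 < N by case: (N) ltN.
  by apply: Or31; exists (i %/ N), (i %% N); rewrite -divn_eq ltn_divLR // ltn_mod.
have [lt2|ge2] := ltnP i (N * N + size cl).
  by apply: Or32; exists (i - N * N); lia.
by apply: Or33; lia.
Qed.

Lemma wf_clause_circuit : wf_circuit C.
Proof.
split=> [|i /gate_cases]; first by rewrite size_gates /= addnA ltn_add2l.
case=> [[a [b [ltaN ltbN ->]]]|[j ltj ->]|->].
- by rewrite nth_gates_pair //= !ltn_addr.
- rewrite nth_gates_or //=; apply/allP => g gc.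
  have [a [b [ltaN ltbN ->]]] := cl_wf (mem_nth _ ltj) gc.
  by rewrite ltn_add2l; nia.
rewrite nth_gates_out; apply/allP => g /mapP[j]; rewrite mem_iota /= => ltj ->.
lia.
Qed.

(** [B] is the contribution of the binary conjunctions: 0 for the weft, 1 for the depth. The clause
    and the output add at most one each. *)
Lemma path_max_clause_circuit (a : pred gate) B : (forall x y, a (And [:: x; y]) <= B) ->
  path_max a C <= B + 2.
Proof.
move=> HB; rewrite /path_max; set rule := fun vs g => _; set V := node_values _ _ _.
have Vin j : j < N -> nth 0 V j = 0.
  by move=> ltj; rewrite nth_node_values_input ?size_nseq // nth_nseq ltj.
have Vg i : i < size (gates C) ->
    nth 0 V (N + i) = rule V (nth (And [::]) (gates C) i).
  move=> lti; rewrite -{1}(size_nseq N 0).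
  apply: nth_node_values => //; first exact: path_max_args.
  by rewrite size_nseq; apply: (wf_clause_circuit.2 _ lti).
have sg := size_gates.
have Vpair x y : x < N -> y < N -> nth 0 V (N + (x * N + y)) <= B.
  move=> ltx lty; rewrite Vg; last by rewrite sg; nia.
  by rewrite nth_gates_pair // /rule /= !big_cons big_nil !Vin // addn0.
have Vor j : j < size cl -> nth 0 V (N + (N * N + j)) <= B + 1.
  move=> ltj; rewrite Vg; last by rewrite sg ltn_add2l leqW.
  rewrite nth_gates_or // /rule /=.
  rewrite [B + 1]addnC; apply: leq_add; first exact: leq_b1.
  apply/bigmax_leqP_seq => g gc _.
  by have [x [y [ltx lty ->]]] := cl_wf (mem_nth _ ltj) gc; apply: Vpair.
rewrite -[output C]/(N + N * N + size cl) -addnA Vg ?sg ?ltn_add2l //.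
rewrite nth_gates_out /rule /= -[2]/(1 + 1) addnA.
rewrite [B + 1 + 1]addnC; apply: leq_add; first exact: leq_b1.
apply/bigmax_leqP_seq => g /mapP[j].
by rewrite mem_iota => ltj -> _; rewrite -addnA; apply: Vor.
Qed.

Lemma weft_clause_circuit : weft C <= 2.
Proof. exact: (path_max_clause_circuit (B := 0)). Qed.

Lemma depth_clause_circuit : depth C <= 3.
Proof. exact: (path_max_clause_circuit (B := 1)). Qed.

Lemma circuit_value_clause (y : N.-tuple bool) :
  circuit_value (C := C) y =
    all (has (fun g => nth false y ((g - N) %/ N) && nth false y ((g - N) %% N))) cl.
Proof.
rewrite /circuit_value; set V := node_values _ _ _.
have Vin j : j < N -> nth false V j = nth false y j.
  by move=> ltj; rewrite nth_node_values_input ?size_tuple.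
have Vg i : i < size (gates C) ->
    nth false V (N + i) = gate_value V (nth (And [::]) (gates C) i).
  move=> lti; rewrite -{1}(size_tuple y).
  apply: nth_node_values => //; first exact: gate_value_args.
  by rewrite size_tuple; apply: (wf_clause_circuit.2 _ lti).
have sg := size_gates.
rewrite -[output C]/(N + N * N + size cl) -addnA Vg ?sg ?ltn_add2l // nth_gates_out /= all_map.
rewrite -{2}(mkseq_nth [::] cl) all_map; apply: eq_in_all => j.
rewrite mem_iota => ltj /=.
rewrite -addnA Vg; last by rewrite sg ltn_add2l leqW.
rewrite nth_gates_or //=.
apply: eq_in_has => g gc; have [a [b [ltaN ltbN ->]]] := cl_wf (mem_nth _ ltj) gc.
rewrite Vg; last by rewrite sg; nia.
rewrite nth_gates_pair //= !Vin // andbT addKn divnMDl; last by case: (N) ltaN.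
by rewrite modnMDl divn_small // modn_small // addn0.
Qed.

End ClauseCircuit.

(** * Assignments that choose one slot in each block *)

Definition pair_gate (n k i u j w : nat) : nat :=
  k * n.+1 + ((i * n.+1 + u) * (k * n.+1) + (j * n.+1 + w)).

Definition clause (n k : nat) (phi : nat -> nat -> nat -> nat -> bool) : seq nat :=
  flatten [seq flatten [seq flatten [seq
    [seq pair_gate n k i u j w | w <- iota 0 n.+1 & phi i u j w]
    | j <- iota 0 k] | u <- iota 0 n.+1] | i <- iota 0 k].

Lemma mem_clause n k (phi : nat -> nat -> nat -> nat -> bool) g : reflect
  (exists i u j w, [/\ i < k, u <= n, j < k, w <= n &
     phi i u j w /\ g = pair_gate n k i u j w]) (g \in clause n k phi).
Proof.
apply: (iffP flatten_mapP) => [[i]|[i [u [j [w [lti leu ltj lew [phi_ ->]]]]]]].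
  rewrite mem_iota => lti /flatten_mapP[u]; rewrite mem_iota => ltu.
  case/flatten_mapP=> j; rewrite mem_iota => ltj /mapP[w].
  by rewrite mem_filter mem_iota => /andP[phi_ ltw] ->; exists i, u, j, w.
exists i; first by rewrite mem_iota.
apply/flatten_mapP; exists u; first by rewrite mem_iota.
apply/flatten_mapP; exists j; first by rewrite mem_iota.
by apply: map_f; rewrite mem_filter phi_ mem_iota.
Qed.

Lemma slot_lt n k i u : i < k -> u <= n -> i * n.+1 + u < k * n.+1.
Proof. by move=> lti leu; nia. Qed.

Lemma clause_wf n k phi g : g \in clause n k phi ->
  exists a b, [/\ a < k * n.+1, b < k * n.+1 & g = k * n.+1 + (a * (k * n.+1) + b)].
Proof.
case/mem_clause=> i [u [j [w [lti leu ltj lew [_ ->]]]]].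
by exists (i * n.+1 + u), (j * n.+1 + w); split=> //; apply: slot_lt.
Qed.

(** When the true inputs are exactly the slots [(i, c i)], the disjunction over all pairs of slots
    collapses to the pairs of chosen ones. *)
Lemma has_clause n k phi (y : nat -> bool) (c : nat -> nat) :
  (forall i, i < k -> c i <= n) ->
  (forall i u, i < k -> u <= n -> y (i * n.+1 + u) = (u == c i)) ->
  has (fun g => y ((g - k * n.+1) %/ (k * n.+1)) && y ((g - k * n.+1) %% (k * n.+1)))
      (clause n k phi) =
  has (fun i => has (fun j => phi i (c i) j (c j)) (iota 0 k)) (iota 0 k).
Proof.
move=> c_le yE; set N := k * n.+1.
have valE i u j w : i < k -> u <= n -> j < k -> w <= n ->
    y ((pair_gate n k i u j w - N) %/ N) && y ((pair_gate n k i u j w - N) %% N) =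
    (u == c i) && (w == c j).
  move=> lti leu ltj lew; have := slot_lt ltj lew; rewrite -/N => ltN.
  rewrite /pair_gate -/N addKn divnMDl; last exact: leq_ltn_trans ltN.
  by rewrite modnMDl divn_small // modn_small // addn0 !yE.
apply/hasP/hasP => [[g /mem_clause]|[i]].
  case=> i [u [j [w [lti leu ltj lew [phi_ ->]]]]]; rewrite valE //.
  case/andP=> /eqP Eu /eqP Ew; subst u w.
  exists i; first by rewrite mem_iota.
  by apply/hasP; exists j; rewrite ?mem_iota.
rewrite mem_iota => lti /hasP[j]; rewrite mem_iota => ltj phi_.
exists (pair_gate n k i (c i) j (c j)); last by rewrite valE ?c_le ?eqxx.
by apply/mem_clause; exists i, (c i), j, (c j); rewrite !c_le.
Qed.

(** Its clause says that some slot of block [i0] is true, because the pairs of a slot with itself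
    are included. *)
Definition block (i0 : nat) : nat -> nat -> nat -> nat -> bool :=
  fun i _ j _ => (i == i0) && (j == i0).

Lemma eq_div_slot n i u i' u' : u <= n -> u' <= n ->
  i * n.+1 + u = i' * n.+1 + u' -> i = i' /\ u = u'.
Proof.
move=> leu leu' E; have : (i * n.+1 + u) %/ n.+1 = (i' * n.+1 + u') %/ n.+1 by rewrite E.
rewrite !divnMDl // !divn_small // !addn0 => Ei; split=> //.
by move: E; rewrite Ei => /addnI.
Qed.

Lemma uniq_slots n k (c : nat -> nat) : (forall i, i < k -> c i <= n) ->
  uniq [seq i * n.+1 + c i | i <- iota 0 k].
Proof.
move=> c_le; rewrite map_inj_in_uniq ?iota_uniq // => i j; rewrite !mem_iota => lti ltj.
by case/eq_div_slot; rewrite ?c_le.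
Qed.

Lemma count_size_true (y : seq bool) :
  count id y = size [seq a <- iota 0 (size y) | nth false y a].
Proof. by rewrite -{1}(mkseq_nth false y) count_map size_filter. Qed.

Lemma select n k (y : seq bool) : size y = k * n.+1 -> count id y = k ->
  (forall i, i < k -> exists2 u, u <= n & nth false y (i * n.+1 + u)) ->
  exists2 c : nat -> nat, forall i, i < k -> c i <= n &
    forall i u, i < k -> u <= n -> nth false y (i * n.+1 + u) = (u == c i).
Proof.
move=> sz_y cnt blk.
pose c i := find (fun u => nth false y (i * n.+1 + u)) (iota 0 n.+1).
have cP i : i < k -> c i <= n /\ nth false y (i * n.+1 + c i).
  move=> /blk[u leu yu].
  have h : has (fun u => nth false y (i * n.+1 + u)) (iota 0 n.+1).
    by apply/hasP; exists u; rewrite ?mem_iota.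
  have ltc : c i < n.+1 by move: h; rewrite has_find size_iota.
  by split=> //; have := nth_find 0 h; rewrite -/(c i) nth_iota.
exists c => [i /cP[] //|i u lti leu]; apply/idP/eqP => [yu|->]; last by case: (cP i lti).
pose s1 := [seq i * n.+1 + c i | i <- iota 0 k].
pose s2 := [seq a <- iota 0 (size y) | nth false y a].
have sub : {subset s1 <= s2}.
  move=> a /mapP[j]; rewrite mem_iota => ltj ->; have [lecj ycj] := cP j ltj.
  by rewrite mem_filter ycj mem_iota sz_y slot_lt.
have u1 : uniq s1 by apply: uniq_slots => j /cP[].
have le21 : size s2 <= size s1 by rewrite size_map size_iota -count_size_true cnt.
(* The chosen slots are k distinct true inputs, and there are only k true inputs, so no other input
   is true. *)
have [_ E] := uniq_min_size u1 sub le21.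
have: i * n.+1 + u \in s1 by rewrite E mem_filter yu mem_iota sz_y slot_lt.
case/mapP=> j; rewrite mem_iota => ltj /eq_div_slot[//||-> //].
by case: (cP j ltj).
Qed.

Lemma unselect n k (c : nat -> nat) : (forall i, i < k -> c i <= n) ->
  exists y : (k * n.+1).-tuple bool, count id y = k /\
    forall i u, i < k -> u <= n -> nth false y (i * n.+1 + u) = (u == c i).
Proof.
move=> c_le; pose y := mkseq (fun a => a %% n.+1 == c (a %/ n.+1)) (k * n.+1).
have sz_y : size y == k * n.+1 by rewrite size_mkseq.
have yE i u : i < k -> u <= n -> nth false y (i * n.+1 + u) = (u == c i).
  move=> lti leu; rewrite nth_mkseq ?slot_lt // modnMDl divnMDl //.
  by rewrite modn_small // divn_small // addn0.
exists (Tuple sz_y); split=> //=.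
rewrite count_size_true (eqP sz_y).
transitivity (size [seq i * n.+1 + c i | i <- iota 0 k]); last by rewrite size_map size_iota.
apply: perm_size; apply: uniq_perm; rewrite ?filter_uniq ?iota_uniq //.
  exact: uniq_slots.
move=> a; rewrite mem_filter mem_iota /=; apply/andP/mapP => [[ya lta]|[i]].
  have lti : a %/ n.+1 < k by rewrite ltn_divLR.
  exists (a %/ n.+1); first by rewrite mem_iota.
  by move: ya; rewrite nth_mkseq // => /eqP <-; apply: divn_eq.
by rewrite mem_iota => lti ->; rewrite yE ?eqxx ?slot_lt ?c_le.
Qed.

Definition clauses n k (Phi : seq (nat -> nat -> nat -> nat -> bool)) : seq (seq nat) :=
  map (clause n k) ([seq block i | i <- iota 0 k] ++ Phi).

Lemma clauses_wf n k Phi c : c \in clauses n k Phi -> forall g, g \in c ->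
  exists a b, [/\ a < k * n.+1, b < k * n.+1 & g = k * n.+1 + (a * (k * n.+1) + b)].
Proof.
rewrite /clauses; elim: (_ ++ _) => //= phi l IH.
by rewrite inE => /predU1P[->|/IH//] g; apply: clause_wf.
Qed.

Lemma clause_circuit_sat n k Phi :
  (exists2 y : (k * n.+1).-tuple bool, count id y = k &
     circuit_value (C := clause_circuit (k * n.+1) (clauses n k Phi)) y) <->
  (exists2 c : nat -> nat, forall i, i < k -> c i <= n &
     all (fun phi => has (fun i => has (fun j => phi i (c i) j (c j)) (iota 0 k)) (iota 0 k))
         Phi).
Proof.
have valE := @circuit_value_clause (k * n.+1) (clauses n k Phi) (@clauses_wf n k Phi).
split=> [[y cnt]|[c c_le sat]].
  rewrite valE /clauses map_cat all_cat => /andP[/allP blk sat].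
  have [|c c_le yE] := select (size_tuple y) cnt.
    move=> i lti; have /blk/hasP[g] :
        clause n k (block i) \in map (clause n k) [seq block i | i <- iota 0 k].
      by rewrite -map_comp; apply: map_f (_ : i \in _); rewrite mem_iota.
    case/mem_clause=> i' [u [j [w [lti' leu ltj lew [/andP[/eqP-> /eqP->] ->]]]]].
    rewrite addKn divnMDl; last exact: leq_ltn_trans (slot_lt lti leu).
    by rewrite divn_small ?slot_lt // addn0 => /andP[yu _]; exists u.
  exists c => //; move: sat; rewrite all_map; congr is_true; apply: eq_all => phi /=.
  exact: (has_clause phi c_le yE).
have [y [cnt yE]] := unselect c_le; exists y => //.
rewrite valE /clauses map_cat all_cat all_map [X in _ && X]all_map; apply/andP; split.
  rewrite all_map; apply/allP => i; rewrite mem_iota => lti /=.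
  rewrite (has_clause _ c_le yE); apply/hasP; exists i; first by rewrite mem_iota.
  by apply/hasP; exists i; rewrite ?mem_iota // /block eqxx.
move: sat; congr is_true; apply: eq_all => phi /=.
by rewrite (has_clause phi c_le yE).
Qed.

(** * Graphs and patterns *)

(** Out of range the entry is [Leaf], which codes both false and 0. *)
Definition entry (x : tree) (u w : nat) : tree :=
  nth Leaf (elems (nth Leaf (elems x) u)) w.

(** True exactly of [Leaf] and [Node Leaf Leaf], since both parts of [Leaf] are [Leaf]. *)
Definition is_bit (e : tree) : bool := ~~ is_node (thead e) && ~~ is_node (ttail e).

Definition is_graph (x : tree) : bool :=
  [&& all (fun r => (tn r == tn x) && all is_bit (elems r)) (elems x),
      all (fun u => ~~ is_node (entry x u u)) (iota 0 (tn x)) &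
      all (fun u => all (fun w => ~~ is_node (entry x u w) || is_node (entry x w u))
                        (iota 0 (tn x))) (iota 0 (tn x))].

Lemma is_bit_code b : is_bit (code_bool b). Proof. by case: b. Qed.
Lemma code_is_node e : is_bit e -> code_bool (is_node e) = e.
Proof. by case: e => //= [[|? ?] []]. Qed.
Lemma is_node_code b : is_node (code_bool b) = b. Proof. by case: b. Qed.

Lemma elems_inj : injective elems.
Proof. by move=> x y E; rewrite -(code_elems x) E code_elems. Qed.

Lemma code_seq_inj (T : Type) (c : T -> tree) : injective c -> injective (code_seq c).
Proof. by move=> c_inj; elim=> [|a l IH] [|b l'] //= [/c_inj-> /IH->]. Qed.

Lemma code_nat_inj : injective code_nat.
Proof. by move=> m n E; rewrite -(tn_code m) E tn_code. Qed.

Lemma code_bool_inj : injective code_bool. Proof. by case=> [] []. Qed.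

Lemma code_gate_inj : injective code_gate.
Proof.
case=> [a|l|l] [a'|l'|l'] //= [].
- by move/code_nat_inj->.
- by move/(code_seq_inj code_nat_inj)->.
- by move/(code_seq_inj code_nat_inj)->.
Qed.

(** The satisfiability problem quantifies over circuits with the given code; injectivity identifies
    such a circuit with the constructed one. *)
Lemma code_circuit_inj : injective code_circuit.
Proof.
case=> [n g o] [n' g' o'] [/code_nat_inj/= -> /(code_seq_inj code_gate_inj)-> ].
by move/code_nat_inj->.
Qed.

Lemma tn_code_seq (T : Type) (c : T -> tree) l : tn (code_seq c l) = size l.
Proof. by rewrite /tn elems_code size_map. Qed.

Lemma tn_code_graph (G : sgraph) : tn (code_graph G) = #|G|.
Proof. by rewrite tn_code_seq size_map -cardE. Qed.

Lemma entry_code (T : Type) (c : T -> tree) (f : nat -> nat -> T) I J i j :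
  i < size I -> j < size J ->
  entry (code_seq (code_seq c) [seq [seq f a b | b <- J] | a <- I]) i j =
  c (f (nth 0 I i) (nth 0 J j)).
Proof.
move=> lti ltj; rewrite /entry elems_code -map_comp (nth_map 0) //=.
by rewrite elems_code -map_comp (nth_map 0).
Qed.

Lemma entry_graph (G : sgraph) (u v : G) :
  entry (code_graph G) (index u (enum G)) (index v (enum G)) = code_bool (adj u v).
Proof.
have lt (w : G) : index w (enum G) < size (enum G) by rewrite index_mem mem_enum.
rewrite /entry elems_code -map_comp (nth_map u) //=.
by rewrite elems_code -map_comp (nth_map v) //= !nth_index ?mem_enum.
Qed.

Lemma ex_index (G : sgraph) p : p < #|G| -> exists v : G, index v (enum G) = p.
Proof.
rewrite cardE; case E: (enum G) => [|x0 e'] // ltp; rewrite -E in ltp *.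
by exists (nth x0 (enum G) p); rewrite index_uniq ?enum_uniq.
Qed.

Lemma entry_out (G : sgraph) p q : (#|G| <= p) || (#|G| <= q) ->
  entry (code_graph G) p q = Leaf.
Proof.
rewrite /entry elems_code -map_comp; have [lep _|ltp /= leq_] := leqP #|G| p.
  by rewrite nth_default // nth_default // size_map -cardE.
have [u <-] := ex_index ltp.
rewrite (nth_map u) ?index_mem ?mem_enum //= elems_code nth_default //.
by rewrite 2!size_map -cardE.
Qed.

Lemma index_lt (G : sgraph) (v : G) : index v (enum G) < #|G|.
Proof. by rewrite cardE index_mem mem_enum. Qed.

Lemma index_enum_inj (G : sgraph) : injective (fun v : G => index v (enum G)).
Proof. by move=> u v; apply: (index_inj u); rewrite mem_enum. Qed.

(** For the converse the graph is built on ['I_n], whose enumeration is increasing, so that its code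
    is [x] itself and not merely a permuted matrix. *)
Lemma is_graphP x : reflect (exists G, x = code_graph G) (is_graph x).
Proof.
apply: (iffP and3P) => [[rows loops syms]|[G ->]]; last first.
  rewrite /is_graph tn_code_graph; split.
  - rewrite elems_code -map_comp all_map; apply/allP => u _ /=.
    rewrite tn_code_seq size_map -cardE eqxx elems_code -map_comp all_map.
    by apply/allP => v _; apply: is_bit_code.
  - apply/allP => p; rewrite mem_iota => /ex_index[v <-].
    by rewrite entry_graph adj_irrefl.
  apply/allP => p; rewrite mem_iota => /ex_index[u <-].
  apply/allP => q; rewrite mem_iota => /ex_index[v <-].
  by rewrite !entry_graph adj_sym; case: adj.
pose n := tn x; pose e : rel 'I_n := fun u w => is_node (entry x u w).
have e_sym : symmetric e.
  move=> u w; have imp a b : a < n -> b < n -> is_node (entry x a b) -> is_node (entry x b a).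
    move=> lta ltb; have a_in : a \in iota 0 n by rewrite mem_iota.
    have b_in : b \in iota 0 n by rewrite mem_iota.
    by have /allP/(_ b b_in)/orP[/negP|] := allP syms a a_in.
  by apply/idP/idP; apply: imp.
have e_irr : irreflexive e.
  by move=> u; apply/negbTE; apply: (allP loops); rewrite mem_iota ltn_ord.
exists (SGraph e_sym e_irr); apply: elems_inj; rewrite elems_code -map_comp.
apply: (@eq_from_nth _ Leaf) => [|i lti]; first by rewrite size_map size_enum_ord.
have /andP[/eqP szr bits] := allP rows _ (mem_nth Leaf lti).
rewrite (nth_map (Ordinal lti)) ?size_enum_ord //=.
apply: elems_inj; rewrite elems_code -map_comp.
apply: (@eq_from_nth _ Leaf) => [|j ltj]; first by rewrite size_map size_enum_ord [n](esym szr).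
have ltjn : j < n by rewrite /n -szr.
rewrite (nth_map (Ordinal lti)) ?size_enum_ord //= /e !nth_enum_ord //.
by rewrite code_is_node //; apply: (allP bits); apply: mem_nth.
Qed.

Lemma uniq_map_inj_in (T U : eqType) (f : T -> U) s :
  uniq (map f s) -> {in s &, injective f}.
Proof.
elim: s => //= a s IH /andP[a_out /IH inj] x y; rewrite !inE.
case/predU1P=> [->|xs] /predU1P[->|ys] // E; last exact: inj.
  by case/negP: a_out; rewrite E map_f.
by case/negP: a_out; rewrite -E map_f.
Qed.

Lemma isomorphic_sym G H : isomorphic G H -> isomorphic H G.
Proof.
case=> f [g fK gK] f_adj; exists g; first by exists f.
by move=> u v; rewrite -{2}(gK u) -{2}(gK v) f_adj.
Qed.

(** The matrix read off the blocks lists the vertices in the order of [ds], not in that of the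
    enumeration of the induced subgraph; an isomorphic copy on ordinals has exactly this matrix.
    This is where invariance of [P] enters. *)
Lemma induced_code (G : sgraph) (ds : seq G) : uniq ds ->
  exists2 H, code_graph H = code_seq (code_seq code_bool) [seq [seq adj u v | v <- ds] | u <- ds]
    & isomorphic H (induced [set v in ds]).
Proof.
move=> ds_uniq; pose d := tnth (in_tuple ds).
have e_sym : symmetric (fun a b => adj (d a) (d b)) by move=> a b; apply: adj_sym.
have e_irr : irreflexive (fun a b => adj (d a) (d b)) by move=> a; apply: adj_irrefl.
have mapd : map d (enum 'I_(size ds)) = ds by rewrite /d map_tnth_enum.
exists (SGraph e_sym e_irr).
  have mapE T (h : G -> T) : map h ds = [seq h (d a) | a <- enum 'I_(size ds)].
    by rewrite (map_comp h d) mapd.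
  rewrite /code_graph /= [in RHS]mapE; congr code_seq; apply: eq_map => a.
  by rewrite [in RHS]mapE.
have d_in a : d a \in [set v in ds] by rewrite inE mem_tnth.
exists (fun a => Sub (d a) (d_in a)) => //.
apply: inj_card_bij => [a b /(congr1 val)/= E|].
  apply: val_inj; apply/eqP; rewrite -(nth_uniq (d a) _ _ ds_uniq) ?ltn_ord //.
  by rewrite -!(tnth_nth _ (in_tuple ds)) -/d E.
by rewrite card_sig card_ord cardsE; apply: card_size.
Qed.

(* The index [tn x], which denotes no vertex, has link 0 to all, itself included. *)
Definition link (x : tree) (u w : nat) : nat :=
  if (u == w) && (u < tn x) then 2 else if is_node (entry x u w) then 1 else 0.

Lemma link_lt3 x u w : link x u w < 3.
Proof. by rewrite /link; case: ifP => // _; case: ifP. Qed.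

Lemma link_eq2 x u w : (link x u w == 2) = (u == w) && (u < tn x).
Proof. by rewrite /link; case: ifP => // _; case: ifP. Qed.

Lemma link_graph (G : sgraph) (u v : G) :
  (link (code_graph G) (index u (enum G)) (index v (enum G)) == 1) = adj u v.
Proof.
rewrite /link tn_code_graph index_lt andbT (inj_eq (@index_enum_inj G)) entry_graph.
have [->|_] := eqVneq u v; first by rewrite adj_irrefl.
by rewrite is_node_code; case: adj.
Qed.

Lemma link_out (G : sgraph) p q : #|G| <= q -> link (code_graph G) p q = 0.
Proof.
move=> leq_; rewrite /link tn_code_graph entry_out ?leq_ ?orbT //=.
by case: eqP => //= ->; rewrite ltnNge leq_.
Qed.

(** Its clause says that the links from [v] do not spell the word [S]. A word is refuted at a single
    position, so the second slot is ignored. *)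
Definition rho_clause (x : tree) (v : nat) (S : tree) : nat -> nat -> nat -> nat -> bool :=
  fun i u _ _ => link x v u != tn (nth Leaf (elems S) i).

Definition P_clause (x M : tree) : nat -> nat -> nat -> nat -> bool :=
  fun i u j w => link x u w != tn (entry M i j).

(** * Enumeration of the patterns *)

Definition words (A : seq tree) (k : nat) : seq tree :=
  iter k (fun L => flatten [seq [seq Node a w | w <- L] | a <- A]) [:: Leaf].

Lemma mem_words A k w : (w \in words A k) = (tn w == k) && all (mem A) (elems w).
Proof.
elim: k w => [|k IH] w; first by case: w => [|a w]; rewrite /= ?inE.
apply/flatten_mapP/andP => [[a aA /mapP[w' Hw ->]]|].
  by move: Hw; rewrite -/(words A k) IH /tn /= aA eqSS => /andP[-> ->].
case: w => [|a w] [] //=; rewrite /tn /= eqSS => szw /andP[aA all_w].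
by exists a => //; apply: map_f; rewrite -/(words A k) IH szw.
Qed.

Definition letters := [:: code_nat 0; code_nat 1; code_nat 2].

Lemma code_tn_letter a : a \in letters -> code_nat (tn a) = a.
Proof. by rewrite !inE => /or3P[] /eqP->; rewrite tn_code. Qed.

Lemma mem_letters n : (code_nat n \in letters) = (n < 3).
Proof.
rewrite !inE !(inj_eq code_nat_inj); by case: n => [|[|[|n]]].
Qed.

(** A letter is determined by its number, so a vector of links is spelled by exactly one tabulated
    word. *)
Lemma word_vector k (f : nat -> nat) : (forall i, f i < 3) ->
  forall S, (S \in words letters k) && all (fun i => tn (nth Leaf (elems S) i) == f i) (iota 0 k)
   = (S == code_seq code_nat [seq f i | i <- iota 0 k]).
Proof.
move=> f_lt S; rewrite mem_words; apply/andP/eqP => [[/andP[/eqP szS lS] /allP E]|->].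
  apply: elems_inj; rewrite elems_code -map_comp.
  apply: (@eq_from_nth _ Leaf) => [|i lti]; first by rewrite size_map size_iota.
  have ltk : i < k by rewrite -szS.
  rewrite (nth_map 0) ?size_iota //= nth_iota //.
  have /eqP <- : tn (nth Leaf (elems S) i) == f i by apply: E; rewrite mem_iota.
  by rewrite code_tn_letter //; apply: (allP lS); apply: mem_nth.
rewrite tn_code_seq size_map size_iota eqxx elems_code -map_comp all_map; split.
  by apply/allP => i _; have := mem_letters (f i); rewrite f_lt.
apply/allP => i; rewrite mem_iota => lti.
by rewrite (nth_map 0) ?size_iota //= nth_iota // tn_code.
Qed.

Lemma word_matrix k (f : nat -> nat -> nat) : (forall i j, f i j < 3) -> forall M,
  (M \in words (words letters k) k) &&
  all (fun i => all (fun j => tn (entry M i j) == f i j) (iota 0 k)) (iota 0 k) =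
  (M == code_seq (code_seq code_nat) [seq [seq f i j | j <- iota 0 k] | i <- iota 0 k]).
Proof.
move=> f_lt M; rewrite mem_words; apply/andP/eqP => [[/andP[/eqP szM lM] /allP E]|->].
  apply: elems_inj; rewrite elems_code -map_comp.
  apply: (@eq_from_nth _ Leaf) => [|i lti]; first by rewrite size_map size_iota.
  have ltk : i < k by rewrite -szM.
  rewrite (nth_map 0) ?size_iota //= nth_iota //.
  apply/eqP; rewrite -(word_vector k (f_lt i)).
  apply/andP; split; first exact: (allP lM _ (mem_nth Leaf lti)).
  by apply: E; rewrite mem_iota.
rewrite tn_code_seq size_map size_iota eqxx elems_code -map_comp all_map; split.
  apply/allP => i _ /=.
  have := eqxx (code_seq code_nat [seq f i j | j <- iota 0 k]).
  by rewrite -(word_vector k (f_lt i)) => /andP[].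
apply/allP => i; rewrite mem_iota => lti; apply/allP => j; rewrite mem_iota => ltj.
by rewrite entry_code ?size_iota // !nth_iota // tn_code.
Qed.

(* The diagonal entries 2 mark the blocks that choose a vertex. *)
Definition chosen (M : tree) : tree :=
  code_seq (code_seq code_bool)
    [seq [seq tn (entry M i j) == 1 | j <- iota 0 (tn M) & tn (entry M j j) == 2]
    | i <- iota 0 (tn M) & tn (entry M i i) == 2].

Section Selections.
Variables (rho_dec : nat -> bool) (P_dec : tree -> bool).

Definition bad_word (S : tree) : bool :=
  all (fun a => ~~ (tn a == 2)) (elems S) &&
  ~~ rho_dec (size [seq a <- elems S | tn a == 1]).

(** A 2 off the diagonal means that two blocks choose the same vertex. The guard keeps [P_dec] away
    from matrices that are not graphs; no selection realises these, so their classification is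
    free. *)
Definition bad_matrix (M : tree) : bool :=
  ~~ (all (fun i => all (fun j => ~~ (tn (entry M i j) == 2) || (i == j))
                        (iota 0 (tn M))) (iota 0 (tn M)) &&
      (is_graph (chosen M) ==> P_dec (chosen M))).

Definition bad_words k := [seq w <- words letters k | bad_word w].
Definition bad_matrices k := [seq M <- words (words letters k) k | bad_matrix M].

Definition conditions (x : tree) k :=
  flatten [seq [seq rho_clause x v w | w <- bad_words k] | v <- iota 0 (tn x)] ++
  [seq P_clause x M | M <- bad_matrices k].

Definition holds k (c : nat -> nat) (phi : nat -> nat -> nat -> nat -> bool) :=
  has (fun i => has (fun j => phi i (c i) j (c j)) (iota 0 k)) (iota 0 k).

(** The clause of [w] fails only when [w] is the word spelled by the selection, so all clauses hold
    if and only if that one word is not bad. *)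
Lemma holds_rho x k c v :
  all (holds k c) [seq rho_clause x v w | w <- bad_words k] =
  ~~ bad_word (code_seq code_nat [seq link x v (c i) | i <- iota 0 k]).
Proof.
pose f i := link x v (c i); have f_lt i : f i < 3 := link_lt3 _ _ _.
have wordP := word_vector k f_lt.
rewrite all_map; apply/allP/idP => [H|not_bad S].
  apply/negP => bad; have := wordP _; rewrite -/f in bad.
  set S0 := code_seq _ _ in bad; move/(_ S0); rewrite eqxx => /andP[inW eqS].
  have /H : S0 \in bad_words k by rewrite mem_filter bad.
  case/hasP=> i i_in /hasP[j _]; rewrite /rho_clause.
  by have := allP eqS i i_in => /eqP->; rewrite eqxx.
rewrite mem_filter => /andP[bad inW]; apply: contraNT not_bad => no_hold.
have /eqP <- : S == code_seq code_nat [seq f i | i <- iota 0 k]; last by [].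
rewrite -wordP inW /=; apply: contraNT no_hold; rewrite -has_predC => /hasP[i i_in /= ne].
apply/hasP; exists i => //; apply/hasP; exists i => //.
by rewrite /rho_clause eq_sym.
Qed.

Lemma holds_P x k c :
  all (holds k c) [seq P_clause x M | M <- bad_matrices k] =
  ~~ bad_matrix (code_seq (code_seq code_nat)
       [seq [seq link x (c i) (c j) | j <- iota 0 k] | i <- iota 0 k]).
Proof.
pose f i j := link x (c i) (c j); have f_lt i j : f i j < 3 := link_lt3 _ _ _.
have wordP := word_matrix k f_lt.
rewrite all_map; apply/allP/idP => [H|not_bad M].
  apply/negP => bad; have := wordP _; rewrite -/f in bad.
  set M0 := code_seq _ _ in bad; move/(_ M0); rewrite eqxx => /andP[inW eqM].
  have /H : M0 \in bad_matrices k by rewrite mem_filter bad.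
  case/hasP=> i i_in /hasP[j j_in]; rewrite /P_clause.
  by have /allP/(_ j j_in)/eqP-> := allP eqM i i_in; rewrite eqxx.
rewrite mem_filter => /andP[bad inW]; apply: contraNT not_bad => no_hold.
have /eqP <- :
  M == code_seq (code_seq code_nat) [seq [seq f i j | j <- iota 0 k] | i <- iota 0 k]; last by [].
rewrite -wordP inW /=; apply: contraNT no_hold; rewrite -has_predC => /hasP[i i_in /=].
rewrite -has_predC => /hasP[j j_in /= ne].
apply/hasP; exists i => //; apply/hasP; exists j => //.
by rewrite /P_clause eq_sym.
Qed.

Variables (rho : nat -> Prop) (P : sgraph -> Prop).
Hypothesis rhoP : forall n, rho n <-> rho_dec n.
Hypothesis P_inv : graph_property P.
Hypothesis PP : forall H, P H <-> P_dec (code_graph H).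

(** [ds] lists the vertices chosen by the blocks, in the order of the blocks and possibly with
    repetitions; the blocks that choose none are skipped. *)
Section Graph.
Variables (G : sgraph) (k : nat) (c : nat -> nat) (ds : seq G).
Let x := code_graph G.
Hypothesis dsE : [seq index v (enum G) | v <- ds] = [seq c i | i <- iota 0 k & c i < #|G|].

(** A letter 2 occurs exactly when [v] is chosen, and a block that chooses none has link 0, so it
    does not disturb the count of neighbours. *)
Lemma bad_word_graph (v : G) :
  ~~ bad_word (code_seq code_nat [seq link x (index v (enum G)) (c i) | i <- iota 0 k])
  = (v \notin ds) ==> rho_dec (count (adj v) ds).
Proof.
rewrite /bad_word elems_code -map_comp negb_and negbK implybE negbK; congr (_ || _).
  rewrite all_map -has_predC -(mem_map (@index_enum_inj G)) dsE.
  apply/hasP/mapP => [[i i_in]|[i]].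
    rewrite /= negbK tn_code link_eq2 tn_code_graph index_lt andbT => /eqP E.
    by exists i => //; rewrite mem_filter i_in -E index_lt.
  rewrite mem_filter => /andP[_ i_in] E; exists i => //.
  by rewrite /= negbK tn_code link_eq2 E eqxx tn_code_graph -E index_lt.
congr rho_dec; rewrite size_filter count_map.
transitivity (count (fun p => link x (index v (enum G)) p == 1)
   [seq c i | i <- iota 0 k & c i < #|G|]).
  rewrite count_map count_filter; apply: eq_count => i /=.
  rewrite tn_code; case: ltnP => [|le]; rewrite ?andbT ?andbF //.
  by rewrite link_out.
by rewrite -dsE count_map; apply: eq_count => u /=; apply: link_graph.
Qed.

(** The absence of a 2 off the diagonal is [uniq ds]; the rows and columns with diagonal entry 2
    form the adjacency matrix of [ds]. *)
Lemma bad_matrix_graph :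
  ~~ bad_matrix (code_seq (code_seq code_nat)
       [seq [seq link x (c i) (c j) | j <- iota 0 k] | i <- iota 0 k]) <->
  uniq ds /\ P (induced [set v in ds]).
Proof.
set M := code_seq _ _; have tnM : tn M = k by rewrite tn_code_seq size_map size_iota.
have entryM i j : i < k -> j < k -> tn (entry M i j) = link x (c i) (c j).
  by move=> lti ltj; rewrite entry_code ?size_iota // !nth_iota // tn_code.
have usedE : [seq i <- iota 0 k | tn (entry M i i) == 2] = [seq i <- iota 0 k | c i < #|G|].
  apply: eq_in_filter => i; rewrite mem_iota => lti.
  by rewrite entryM // link_eq2 eqxx tn_code_graph.
have chosenE : chosen M =
    code_seq (code_seq code_bool) [seq [seq adj u v | v <- ds] | u <- ds].
  rewrite /chosen tnM usedE; congr code_seq.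
  have dsE' := dsE; set U := filter _ _ in dsE' *.
  have U_lt i : i \in U -> i < k by rewrite mem_filter mem_iota => /andP[].
  transitivity [seq [seq link x p q == 1 | q <- map c U] | p <- map c U].
    rewrite -map_comp; apply/eq_in_map => i /U_lt lti /=.
    by rewrite -map_comp; apply/eq_in_map => j /U_lt ltj /=; rewrite entryM.
  rewrite -dsE' -map_comp; apply: eq_map => u /=.
  by rewrite -map_comp; apply: eq_map => v /=; apply: link_graph.
have -> : ~~ bad_matrix M = uniq ds && (is_graph (chosen M) ==> P_dec (chosen M)).
  rewrite /bad_matrix negbK tnM; congr (_ && _).
  rewrite -(map_inj_uniq (@index_enum_inj G)) dsE; apply/allP/idP => [H|c_uniq i i_in].
    rewrite map_inj_in_uniq ?filter_uniq ?iota_uniq // => i j.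
    rewrite !mem_filter => /andP[lti i_in] /andP[_ j_in] E; apply/eqP.
    have := allP (H i i_in) j j_in; rewrite !mem_iota in i_in j_in.
    by rewrite entryM // link_eq2 E eqxx tn_code_graph -E lti.
  apply/allP => j j_in; move: (i_in) (j_in); rewrite !mem_iota => lti ltj.
  rewrite entryM // link_eq2 tn_code_graph; apply/orP.
  case: (i =P j) => [->|ne]; [by right | left]; apply/negP => /andP[/eqP E ltc].
  apply: ne; apply: (uniq_map_inj_in c_uniq _ _ E); rewrite mem_filter ?i_in ?j_in ?ltc //.
  by rewrite -E ltc.
split=> [/andP[ds_uniq]|[ds_uniq PD]]; have [H HE iso] := induced_code ds_uniq;
  rewrite chosenE -HE.
  have -> : is_graph (code_graph H) by apply/is_graphP; exists H.
  by move/PP/(P_inv iso).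
rewrite ds_uniq /=; apply/implyP => _; apply/PP; exact: P_inv (isomorphic_sym iso) PD.
Qed.

End Graph.

Lemma ex_list (G : sgraph) (C : seq nat) : all (fun p => p < #|G|) C ->
  exists ds : seq G, [seq index v (enum G) | v <- ds] = C.
Proof.
elim: C => [|p C IH] /=; first by exists [::].
case/andP=> /ex_index[v <-] /IH[ds <-]; by exists (v :: ds).
Qed.

Lemma selection_graph (G : sgraph) k :
  (exists2 c : nat -> nat, forall i, i < k -> c i <= tn (code_graph G) &
     all (holds k c) (conditions (code_graph G) k)) <->
  (exists D : {set G}, [/\ #|D| <= k, P (induced D) &
     forall v, v \notin D -> rho #|nbh v :&: D|]).
Proof.
(* Serves both directions: one reads [ds] off a selection [c], the other builds [c] from an
   enumeration of D. *)
have condE c (ds : seq G) :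
    [seq index v (enum G) | v <- ds] = [seq c i | i <- iota 0 k & c i < #|G|] ->
    all (holds k c) (conditions (code_graph G) k) <->
    [/\ uniq ds, P (induced [set v in ds]) & forall v, v \notin ds -> rho (count (adj v) ds)].
  move=> dsE; rewrite /conditions all_cat holds_P.
  rewrite tn_code_graph; have bm := bad_matrix_graph dsE.
  have fl (l : seq nat) (F : nat -> seq _) :
      all (holds k c) (flatten [seq F v | v <- l]) = all (fun v => all (holds k c) (F v)) l.
    by elim: l => //= v l IH; rewrite all_cat IH.
  rewrite fl; split=> [/andP[/allP ok /bm[u PD]]|[u PD ok]].
    split=> // v v_out; apply/rhoP.
    have := ok (index v (enum G)); rewrite mem_iota index_lt => /(_ isT).
    by rewrite holds_rho (bad_word_graph dsE) v_out.
  apply/andP; split; last by apply/bm.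
  apply/allP => p; rewrite mem_iota => /ex_index[v <-].
  by rewrite holds_rho (bad_word_graph dsE); apply/implyP => /ok/rhoP.
have countE (ds : seq G) v : uniq ds -> count (adj v) ds = #|nbh v :&: [set u in ds]|.
  move=> u; rewrite -size_filter -(card_uniqP (filter_uniq _ u)).
  by apply: eq_card => w; rewrite !inE mem_filter.
split=> [[c c_le sat]|[D [leD PD ok]]].
  have [|ds dsE] := @ex_list G [seq c i | i <- iota 0 k & c i < #|G|].
    by rewrite all_map; apply/allP => i; rewrite mem_filter => /andP[].
  have [u PD ok] := (condE c ds dsE).1 sat.
  exists [set v in ds]; split=> // [|v]; last by rewrite inE -countE //; apply: ok.
  rewrite cardsE (leq_trans (card_size ds)) // -(size_map (fun v => index v (enum G))) dsE.
  by rewrite size_map size_filter (leq_trans (count_size _ _)) // size_iota.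
(* The default [#|G|] makes the blocks beyond the size of D choose no vertex. *)
pose ds := enum D; pose c i := nth #|G| [seq index v (enum G) | v <- ds] i.
have szds : size ds <= k by rewrite -cardE.
have DE : [set v in ds] = D by apply/setP => v; rewrite inE mem_enum.
have dsE : [seq index v (enum G) | v <- ds] = [seq c i | i <- iota 0 k & c i < #|G|].
  rewrite -(subnKC szds) iotaD filter_cat map_cat.
  have -> : [seq i <- iota (0 + size ds) (k - size ds) | c i < #|G|] = [::].
    apply/eqP; rewrite -size_eq0 size_filter -leqn0 leqNgt -has_count; apply/hasPn => i.
    by rewrite mem_iota => /andP[lei _]; rewrite /c nth_default ?ltnn // size_map.
  rewrite cats0 (_ : [seq i <- _ | _] = iota 0 (size ds)).
    by rewrite /c -(size_map (fun v => index v (enum G)) ds) map_nth_iota0 ?take_size.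
  apply/all_filterP/allP => i; rewrite mem_iota => lti; rewrite /c.
  have /mapP[v _ ->] : nth #|G| [seq index v (enum G) | v <- ds] i \in
    [seq index v (enum G) | v <- ds] by rewrite mem_nth ?size_map.
  exact: index_lt.
exists c => [i _|].
  rewrite tn_code_graph /c; have [lti|lei] := ltnP i (size ds); last first.
    by rewrite nth_default ?size_map.
  have /mapP[v _ ->] : nth #|G| [seq index v (enum G) | v <- ds] i \in
    [seq index v (enum G) | v <- ds] by rewrite mem_nth ?size_map.
  exact/ltnW/index_lt.
apply/(condE c ds dsE); rewrite DE; split=> // [|v]; first exact: enum_uniq.
by rewrite countE ?enum_uniq // DE mem_enum; apply: ok.
Qed.

End Selections.

(** * The reduction *)

Lemma poly_entry x i j : poly x -> poly (fun z => code_nat (i z)) ->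
  poly (fun z => code_nat (j z)) -> poly (fun z => entry (x z) (i z) (j z)).
Proof. by move=> Px Pi Pj; rewrite /entry; polytac. Qed.

Lemma poly_is_bit f : poly f -> poly (fun x => code_bool (is_bit (f x))).
Proof. by move=> Pf; rewrite /is_bit; polytac. Qed.

Lemma poly_link x u w : poly x -> poly (fun z => code_nat (u z)) ->
  poly (fun z => code_nat (w z)) -> poly (fun z => code_nat (link (x z) (u z) (w z))).
Proof.
move=> Px Pu Pw; have Pe := poly_entry Px Pu Pw; rewrite /link.
apply: poly_if; first by polytac.
  exact: poly_const.
by apply: poly_if; polytac.
Qed.

Ltac graphtac := repeat first [ poly_step | lazymatch goal with
  | |- poly (fun x => entry _ _ _) => apply: poly_entry
  | |- poly (fun x => code_bool (is_bit _)) => apply: poly_is_bit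
  | |- poly (fun x => code_nat (link _ _ _)) => apply: poly_link
  end ].

Lemma poly_is_graph f : poly f -> poly (fun x => code_bool (is_graph (f x))).
Proof.
apply: (poly_comp (f := fun x => code_bool (is_graph x))).
by rewrite /is_graph; graphtac.
Qed.

Lemma poly_chosen : poly chosen.
Proof. by rewrite /chosen; graphtac. Qed.

Lemma poly_clause n k (phi : tree -> nat -> nat -> nat -> nat -> bool) :
  poly (fun x => code_nat (n x)) -> poly (fun x => code_nat (k x)) ->
  poly (fun y => code_bool (phi (thead (thead (thead (thead y))))
     (tn (ttail (thead (thead (thead y))))) (tn (ttail (thead (thead y))))
     (tn (ttail (thead y))) (tn (ttail y)))) ->
  poly (fun x => code_seq code_nat (clause (n x) (k x) (phi x))).
Proof.
move=> Pn Pk Pphi; rewrite /clause /pair_gate; graphtac.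
Qed.

Lemma poly_clause_circuit N cl : poly (fun x => code_nat (N x)) ->
  poly (fun x => code_seq (code_seq code_nat) (cl x)) ->
  poly (fun x => code_circuit (clause_circuit (N x) (cl x))).
Proof.
move=> PN Pcl; rewrite /code_circuit /=.
have Psz := poly_seqsize Pcl.
have Pand f : poly (fun x => code_seq code_nat (f x)) -> poly (fun x => code_gate (And (f x))).
  by move=> Pf; apply: poly_node => //; apply: poly_const.
have Por : poly (fun x => code_seq code_gate (map Or (cl x))).
  pose s (_ a : tree) := Node (code_nat 2) a.
  have: poly (fun x => code_seq id [seq s x a | a <- elems (code_seq (code_seq code_nat) (cl x))]).
    apply: (poly_map (c := id) (s := s)); first exact: poly_elems.
    by rewrite /s; polytac.
  apply: poly_ext => x; rewrite elems_code -!map_comp.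
  by rewrite [RHS]code_seq_map -map_comp.
apply: poly_node => //; apply: poly_node; last by polytac.
apply: poly_cat; last apply: poly_cat => //.
  apply: poly_flatten; apply: poly_mapn => //; apply: poly_mapn; first by polytac.
  by apply: (Pand (fun y => [:: _; _])); polytac.
apply: poly_node; last exact: poly_const.
by apply: (Pand (fun x => map _ _)); polytac.
Qed.

(** The number of words is exponential in their length, so only halting is claimed. *)
Lemma tot_words : tot (fun y => code_seq id (words (elems (thead y)) (tn (ttail y)))).
Proof.
pose S y := code_seq id (flatten
  [seq [seq Node a w | w <- elems (ttail (ttail y))] | a <- elems (thead (thead y))]).
have PS : poly S.
  by rewrite /S; polytac.
have foldE x l L : foldl (fold_step S x) (code_seq id L) l =
    code_seq id (iter (size l) (fun L => flatten
      [seq [seq Node a w | w <- L] | a <- elems (thead x)]) L).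
  elim: l L => //= a l IH L; rewrite {2}/S /= elems_id IH.
  by rewrite -iterSr iterS.
apply: tot_ext (tot_foldl (poly_tot (poly_const (Node Leaf Leaf)))
  (poly_tot (poly_tail poly_id)) (poly_tot PS)) => x.
exact: (foldE x _ [:: Leaf]).
Qed.

Lemma tot_sub (D D' : pred tree) f : subpred D D' -> tot_on D' f -> tot_on D f.
Proof. by move=> sub [p Hp]; exists p => x /sub; apply: Hp. Qed.

Lemma tot_comp_tot f g : tot f -> tot g -> tot (fun x => f (g x)).
Proof. exact: (@tot_comp predT predT). Qed.

Lemma tot_filter (b : tree -> bool) l : tot (fun x => code_bool (b x)) ->
  tot (fun x => code_seq id (l x)) -> tot (fun x => code_seq id [seq a <- l x | b a]).
Proof.
move=> Tb Tl.
pose b' y := b (thead (ttail y)).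
pose S y := if b' y then ttail y else ttail (ttail y).
have TS : tot S.
  apply: tot_if.
  - apply: (tot_comp_tot Tb); apply: poly_tot; polytac.
  - by apply: (@tot_sub _ predT) => //; apply: poly_tot; polytac.
  - by apply: poly_tot; polytac.
have foldE x L z : foldl (fold_step S x) z L = code_seq id (catrev [seq a <- L | b a] (elems z)).
  elim: L z => /= [|a L IH] z; first by rewrite code_elems.
  by rewrite IH /S /b' /=; case: (b a).
have Tr : tot (fun x => code_seq id (rev [seq a <- l x | b a])).
  apply: tot_ext (tot_foldl (poly_tot (poly_const Leaf)) Tl TS) => x.
  by rewrite foldE elems_id catrevE cats0.
have Prev : poly (fun y => code_seq id (rev (elems y))) by apply: poly_rev; polytac.
apply: tot_ext (tot_comp_tot (poly_tot Prev) Tr) => x.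
by rewrite elems_id revK.
Qed.

Lemma tot_andN b b' : tot (fun x => code_bool (b x)) -> tot (fun x => code_bool (b' x)) ->
  tot (fun x => code_bool (b x && ~~ b' x)).
Proof.
move=> Tb Tb'.
have P : poly (fun y => code_bool (is_node (thead y) && ~~ is_node (ttail y))) by polytac.
apply: tot_ext (tot_comp_tot (poly_tot P) (tot_node Tb Tb')) => x /=.
by rewrite !is_node_code.
Qed.

(** * The table of bad patterns *)

Section Tables.
Variables (rho_dec : nat -> bool) (P_dec : tree -> bool) (p_rho p_P : prog).
Hypothesis rho_prog : forall n, computes p_rho (code_nat n) (code_bool (rho_dec n)).
Hypothesis P_prog : forall x, is_graph x -> computes p_P x (code_bool (P_dec x)).

Lemma tot_bad_word : tot (fun w => code_bool (bad_word rho_dec w)).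
Proof.
apply: tot_andN; first by apply: poly_tot; polytac.
(* [p_rho] is only known to halt on unary codes; this is a decidable description of them. *)
pose D (y : tree) := y == code_nat (tn y).
pose F y := code_bool (rho_dec (tn y)).
pose g w := code_nat (size [seq a <- elems w | tn a == 1]).
apply: (tot_ext (f := fun w => F (g w))) => [w|]; first by rewrite /F /g tn_code.
apply: (tot_comp (D' := D)) => [w _||].
- by rewrite /D /g tn_code.
- by exists p_rho => y /eqP ->; rewrite /F tn_code.
- apply: poly_tot; apply: (poly_seqsize (c := id)); polytac.
Qed.

Lemma tot_bad_matrix : tot (fun M => code_bool (bad_matrix P_dec M)).
Proof.
pose F y := code_bool (is_graph y ==> P_dec y).
have TF : tot F.
  (* The implication must be computed by branching: [p_P] may diverge when the test fails. *)
  have : tot (fun y => if is_graph y then code_bool (P_dec y) else code_bool true).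
    apply: tot_if; first by apply: poly_tot; apply: poly_is_graph; polytac.
      by exists p_P.
    by apply: poly_tot; polytac.
  by apply: tot_ext => y; rewrite /F; case: is_graph.
have T1 : tot (fun M => code_bool (all (fun i => all (fun j =>
    ~~ (tn (entry M i j) == 2) || (i == j)) (iota 0 (tn M))) (iota 0 (tn M)))).
  by apply: poly_tot; graphtac.
have T2 := tot_comp_tot TF (poly_tot poly_chosen).
have P : poly (fun y => code_bool (~~ (is_node (thead y) && is_node (ttail y)))) by polytac.
apply: tot_ext (tot_comp_tot (poly_tot P) (tot_node T1 T2)) => M /=.
by rewrite !is_node_code.
Qed.

Definition table (y : tree) : tree :=
  Node y (Node (code_seq id (bad_words rho_dec (tn y)))
               (code_seq id (bad_matrices P_dec (tn y)))).

Lemma tot_table : tot table.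
Proof.
have Tid := poly_tot poly_id.
have T1 : tot (fun y => code_seq id (words letters (tn y))).
  by apply: tot_ext (tot_comp_tot tot_words
    (tot_node (poly_tot (poly_const (code_seq id letters))) Tid)) => y.
have T2 : tot (fun y => code_seq id (words (words letters (tn y)) (tn y))).
  by apply: tot_ext (tot_comp_tot tot_words (tot_node T1 Tid)) => y; rewrite /= elems_id.
apply: tot_node => //; apply: tot_node.
  exact: tot_filter tot_bad_word T1.
exact: tot_filter tot_bad_matrix T2.
Qed.

End Tables.

Definition table_conditions (x R Q : tree) :=
  flatten [seq [seq rho_clause x v w | w <- elems R] | v <- iota 0 (tn x)] ++
  [seq P_clause x M | M <- elems Q].

(** The argument is the instance paired with its table. [Leaf] is the code of no circuit, so a tree
    that encodes no graph becomes a no-instance. *)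
Definition reduction (z : tree) : tree :=
  let x := thead z in let y := thead (ttail z) in
  Node (if is_graph x then
          code_circuit (clause_circuit (tn y * (tn x).+1) (clauses (tn x) (tn y)
            (table_conditions x (thead (ttail (ttail z))) (ttail (ttail (ttail z))))))
        else Leaf) y.

Lemma poly_reduction : poly reduction.
Proof.
rewrite /reduction; apply: poly_node; last by polytac.
apply: (poly_if (c := id)); [by apply: poly_is_graph; polytac| |exact: poly_const].
apply: poly_clause_circuit; first by polytac.
(* The conditions are functions and have no code; moving [clause] inside the lists leaves only lists
   of coded data. *)
have Eq z : clauses (tn (thead z)) (tn (thead (ttail z)))
   (table_conditions (thead z) (thead (ttail (ttail z))) (ttail (ttail (ttail z)))) =
   [seq clause (tn (thead z)) (tn (thead (ttail z))) (block i)
     | i <- iota 0 (tn (thead (ttail z)))] ++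
   flatten [seq [seq clause (tn (thead z)) (tn (thead (ttail z))) (rho_clause (thead z) v w)
     | w <- elems (thead (ttail (ttail z)))] | v <- iota 0 (tn (thead z))] ++
   [seq clause (tn (thead z)) (tn (thead (ttail z))) (P_clause (thead z) M)
     | M <- elems (ttail (ttail (ttail z)))].
  rewrite /clauses /table_conditions !map_cat -!map_comp map_flatten -map_comp.
  by congr (_ ++ (flatten _ ++ _)); apply: eq_map => v /=; rewrite -map_comp.
apply: (poly_ext (f := fun z => code_seq (code_seq code_nat) _)) => [z|].
  by rewrite Eq.
apply: poly_cat; last apply: poly_cat.
- apply: poly_mapn; first by polytac.
  apply: (poly_clause (phi := fun y => block (tn (ttail y)))); first by polytac.
    by polytac.
  by rewrite /block; polytac.
- apply: poly_flatten; apply: poly_mapn; first by polytac.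
  apply: (poly_map (s := fun y w => clause _ _ (rho_clause _ _ w))); first by polytac.
  apply: (poly_clause (phi := fun y =>
    rho_clause (thead (thead (thead y))) (tn (ttail (thead y))) (ttail y))).
  + by polytac.
  + by polytac.
  by rewrite /rho_clause; graphtac.
apply: (poly_map (s := fun y M => clause _ _ (P_clause _ M))); first by polytac.
apply: (poly_clause (phi := fun y => P_clause (thead (thead y)) (ttail y))).
+ by polytac.
+ by polytac.
by rewrite /P_clause; graphtac.
Qed.

Lemma reductionP (rho : nat -> Prop) (P : sgraph -> Prop)
    (rho_dec : nat -> bool) (P_dec : tree -> bool) x k :
  (forall n, rho n <-> rho_dec n) -> graph_property P ->
  (forall H, P H <-> P_dec (code_graph H)) ->
  dominating_set_of_size_at_most P rho x k <->
  weighted_circuit_sat 2 3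
    (thead (reduction (Node x (table rho_dec P_dec (code_nat k))))) k.
Proof.
move=> rhoP P_inv PP; rewrite /= tn_code.
have -> : table_conditions x (code_seq id (bad_words rho_dec k))
    (code_seq id (bad_matrices P_dec k)) = conditions rho_dec P_dec x k.
  by rewrite /table_conditions !elems_id.
set Phi := conditions _ _ _ _; set C := clause_circuit _ _.
have selP G := selection_graph rhoP P_inv PP G k.
have satP := clause_circuit_sat (tn x) k Phi.
case: is_graphP => [[G xG]|not_graph].
  rewrite -/C; split=> [[H xH HD]|[C' [/code_circuit_inj eC _ _ _ sat]]].
    exists C; split=> //.
    - exact/wf_clause_circuit/clauses_wf.
    - exact/weft_clause_circuit/clauses_wf.
    - exact/depth_clause_circuit/clauses_wf.
    by apply/satP; rewrite /Phi xH; apply/selP.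
  rewrite -eC in sat.
  by exists G => //; apply/selP; rewrite -xG; apply/satP.
split=> [[H xH _]|[C' []]] //.
by case: not_graph; exists H.
Qed.

Theorem theorem6 (rho : nat -> Prop) (P : sgraph -> Prop)
  (rho_rec : recursive code_nat rho)
  (P_inv : graph_property P)
  (P_rec : recursive code_graph P) :
  W 2 (dominating_set_of_size_at_most P rho).
Proof.
case: rho_rec => p_rho /= rho_rec; case: P_rec => p_P /= P_rec.
have [rho_dec rho_decP] : exists d : nat -> bool, forall n,
    computes p_rho (code_nat n) (code_bool (d n)) /\ (rho n <-> d n).
  apply: (functional_choice (fun n (b : bool) =>
    computes p_rho (code_nat n) (code_bool b) /\ (rho n <-> b))) => n.
  by have [b] := rho_rec n; exists b.
(* A decision on trees is wanted, although [P_rec] speaks of graphs: determinism gives all graphs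
   with one code the same answer. *)
have [P_dec P_decP] : exists d : tree -> bool, forall x, forall H, x = code_graph H ->
    computes p_P x (code_bool (d x)) /\ (P H <-> d x).
  apply: (functional_choice (fun x (b : bool) => forall H, x = code_graph H ->
    computes p_P x (code_bool b) /\ (P H <-> b))) => x.
  have [[G ->]|not_graph] := is_graphP x; last first.
    by exists true => H xH; case: not_graph; exists H.
  have [b Hb _] := P_rec G; exists b => H eGH; split=> //.
  have [b' [t' [s' run' E']] PH] := P_rec H.
  have [t [s run E]] := Hb; rewrite -eGH in run'.
  have eqs := exec_det run run'.
  have eb : b' = b by apply: code_bool_inj; rewrite -E' -E (exec_det run run').
  by rewrite -eb.
have rho_prog n := (rho_decP n).1.
have P_prog x : is_graph x -> computes p_P x (code_bool (P_dec x)).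
  by case/is_graphP=> G /P_decP[].
pose tab := table rho_dec P_dec.
have [p_tab tabP] : tot tab := tot_table rho_prog P_prog.
have [q clockP] := computes_clock p_tab.
(* The first component is the actual running time of the tabulation, the second a bound for it that
   the program [q] computes. *)
have [h hP] : exists h : nat -> nat * nat, forall k,
    [/\ computes_in p_tab (code_nat k) (h k).1 (tab (code_nat k)),
        computes q (code_nat k) (code_nat (h k).2) &
        tsize (code_nat k) + (h k).1 <= (h k).2].
  apply: (functional_choice (fun k (tn : nat * nat) =>
    [/\ computes_in p_tab (code_nat k) tn.1 (tab (code_nat k)),
        computes q (code_nat k) (code_nat tn.2) & tsize (code_nat k) + tn.1 <= tn.2])) => k.
  have [t run] := tabP (code_nat k) isT; have [n Hn le_n] := clockP _ _ _ run.
  by exists (t, n).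
pose H k := (h k).2.
pose input (i : tree * nat) := Node i.1 (code_nat i.2).
pose Dz z := exists i, z = input i.
have poly_runs f : poly f -> exists2 T, pbnd tsize T & runs Dz f T.
  by case=> T PT [p Hp]; exists T => //; exists p => x _; apply: Hp.
have [Th PTh Hth] := poly_runs _ (poly_head poly_id).
have [Tt PTt Htt] := poly_runs _ (poly_tail poly_id).
have Htab : runs (fun y => exists k, y = code_nat k) tab (fun y => H (tn y)).
  exists p_tab => _ [k ->]; have [run _ le] := hP k; exists (h k).1 => //.
  by rewrite tn_code (leq_trans _ le) // leq_addl.
have [|K1 Htt'] := runs_comp _ Htab Htt; first by move=> _ [i ->]; exists i.2.
have [K2 Hpre] := runs_pair Hth Htt'.
have [Tr PTr Hr] := poly_reduction.
have [|K3 [p Hp]] := runs_comp _ Hr Hpre; first by [].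
(* Everything is polynomial in this measure: [H k] bounds the time of the tabulation and the size of
   its result. *)
pose sz (i : tree * nat) := tsize i.1 + H i.2.
have szin : pbnd sz (fun i => tsize (input i)).
  apply: pb_le (pb_add (pb_size sz) (pb_const sz 1)) _ => -[x k] /=.
  have [_ _ le] := hP k; rewrite /sz /H /=; lia.
have szpre : pbnd sz (fun i => tsize (Node (thead (input i)) (tab (ttail (input i))))).
  apply: pb_le (pb_add (pb_size sz) (pb_const sz 1)) _ => -[x k].
  have [run _ le] := hP k; have := computes_in_size run.
  have tsize_node a b : tsize (Node a b) = (tsize a + tsize b).+1 by [].
  rewrite /sz /H tsize_node.
  change (ttail (input (x, k))) with (code_nat k); change (thead (input (x, k))) with x.
  by move: (tab _) => y /=; lia.
have PTh' := pb_comp PTh szin; have PTt' := pb_comp PTt szin.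
have PTr' := pb_comp PTr szpre.
have PH : pbnd sz (fun i => H (tn (ttail (input i)))).
  apply: pb_le (pb_size sz) _ => -[x k] /=; rewrite tn_code; exact: leq_addl.
have [c Hc] : pbnd sz (fun i => K2 + tsize (input i) * 4 + Th (input i) * 2
    + (Tt (input i) + (K1 + H (tn (ttail (input i))))) * 2
    + (K3 + Tr (Node (thead (input i)) (tab (ttail (input i)))))).
  by pbtac.
(* As [tsize x] is positive, [tsize x + H k + 2] is at most [(H k + 3) * tsize x], which splits the
   bound into a function of k times a power of the input size. The depth is 3, and the parameter is
   unchanged. *)
exists 3, p, (fun k => (H k + 3) ^ c), id, c; split.
- have Pf : poly (fun y => code_nat ((tn y + 3) ^ c)) by apply: poly_exp; polytac.
  pose D (y : tree) := y == code_nat (tn y).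
  have Hq : tot_on D (fun y => code_nat (H (tn y))).
    by exists q => y /eqP->; rewrite tn_code; have [] := hP (tn y).
  have [r Hr'] := tot_comp (D' := predT) (fun _ _ => isT) (poly_tot Pf) Hq.
  by exists r => n; have := Hr' (code_nat n); rewrite /D !tn_code; apply.
- have [p_id Hid] := poly_tot poly_id.
  by exists p_id => n; apply: Hid.
move=> x k; have [t run let_] := Hp (input (x, k)) (ex_intro _ (x, k) erefl).
exists (thead (reduction (Node x (tab (code_nat k))))), k, t; split=> //.
  apply: leq_trans let_ (leq_trans (Hc (x, k)) _); rewrite -expnMn leq_exp2 // /sz /=.
  by have := tsize_gt0 x; nia.
apply: (@reductionP rho P rho_dec P_dec x k) => // [n|G].
  exact: (rho_decP n).2.
exact: (P_decP _ G erefl).2.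
Qed.
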